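(* Assume that either $\lim_{k\to\infty}R_k=+\infty$ (all eigenvalues of $R_k$ tend to infinity), or $\mathrm{i}\notin\sigma(A)$ and $\lim_{k\to\infty}Q_k=+\infty$. Then the recovery procedure of the potential $\{C_k\}$ from the minimal realization triple $\{\mathcal{A},\mathcal{B},\mathcal{C}\}$ is stable in the class $\mathcal{G}_n$: for every $\varepsilon>0$ there exist $\delta>0$ such that for every triple $\{\widetilde{\mathcal A},\widetilde{\mathcal B},\widetilde{\mathcal C}\}\in\mathcal{G}_n$ with $\|\mathcal{A}-\widetilde{\mathcal A}\|+\|\mathcal{B}-\widetilde{\mathcal B}\|+\|\mathcal{C}-\widetilde{\mathcal C}\|<\delta$, the potential $\{\widetilde C_k\}$ constructed by the same procedure (with $\widetilde X>0$ the solution of $\widetilde X\widetilde{\mathcal B}\widetilde{\mathcal B}^*\widetilde X-\mathrm{i}(\widetilde{\mathcal A}^*\widetilde X-\widetilde X\widetilde{\mathcal A})+\widetilde{\mathcal C}^*\widetilde{\mathcal C}=0$ lying close to $X$) satisfies $\|C_k-\widetilde C_k\|<\varepsilon$ for all $k\geq 0$.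
   Context: Let $j=\mathrm{diag}\{I_{m_1},-I_{m_2}\}$, $m_1+m_2=m$, and consider the discrete self-adjoint Dirac system $y_{k+1}(z)=(I_m+\mathrm{i} zjC_k)y_k(z)$ ($k\in\mathbb{N}_0$) with $C_k>0$, $C_kjC_k=j$. Its Weyl function is the $m_1\times m_2$ matrix function $\varphi$ on $\mathbb{C}_-$ with $\sum_{k\ge0}(1+|z|^2)^{-k}\begin{bmatrix}\varphi^*& I_{m_2}\end{bmatrix}W_k^*C_kW_k\begin{bmatrix}\varphi\\ I_{m_2}\end{bmatrix}<\infty$, where $W_k$ is the fundamental solution with $W_0=I_m$. Suppose $\psi(z)=\varphi(-1/z)$ is a strictly proper rational function, contractive on $\mathbb{C}_-$, with minimal realization $\psi(z)=\mathcal{C}(zI_n-\mathcal{A})^{-1}\mathcal{B}$. Recovery procedure: take the unique Hermitian (in fact positive) solution $X>0$ of the Riccati equation $X\mathcal{B}\mathcal{B}^*X-\mathrm{i}(\mathcal{A}^*X-X\mathcal{A})+\mathcal{C}^*\mathcal{C}=0$ satisfying $\sigma(\mathcal{A}-\mathrm{i}\mathcal{B}\mathcal{B}^*X)\subset\mathbb{C}_+\cup\mathbb{R}$; set $A=\mathcal{A}-\mathrm{i}\mathcal{B}\mathcal{B}^*X$, $S_0=X^{-1}$, $\vartheta_1=\mathrm{i}X^{-1}\mathcal{C}^*$, $\vartheta_2=\mathcal{B}$, $\Pi_0=[\vartheta_1\ \ \vartheta_2]$; define recursively $\Pi_{k+1}=\Pi_k+\mathrm{i}A^{-1}\Pi_kj$,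 $S_{k+1}=S_k+A^{-1}S_k(A^* )^{-1}+A^{-1}\Pi_k\Pi_k^*(A^* )^{-1}$, and $C_k=I_m+\Pi_k^*S_k^{-1}\Pi_k-\Pi_{k+1}^*S_{k+1}^{-1}\Pi_{k+1}$. Then $\{C_k\}$ is the (unique) potential whose Weyl function is $\varphi$. Define $R_r=(I_n+\mathrm{i}A^{-1})^{-r}S_r(I_n-\mathrm{i}(A^* )^{-1})^{-r}$ (equivalently $R_0=S_0$ and $R_{k+1}-R_k=2(I_n+\mathrm{i}A^{-1})^{-k-1}A^{-1}(I_n-\mathrm{i}A^{-1})^k\vartheta_2\vartheta_2^*((I_n-\mathrm{i}A^{-1})^k)^*(A^{-1})^*((I_n+\mathrm{i}A^{-1})^{-k-1})^*$), and, when $\mathrm{i}\notin\sigma(A)$, $Q_r=(I_n-\mathrm{i}A^{-1})^{-r}S_r(I_n+\mathrm{i}(A^* )^{-1})^{-r}$. The class $\mathcal{G}_n$ consists of triples $\{\widetilde{\mathcal A},\widetilde{\mathcal B},\widetilde{\mathcal C}\}$ determining minimal realizations $\widetilde{\mathcal C}(zI_n-\widetilde{\mathcal A})^{-1}\widetilde{\mathcal B}$ of $m_1\times m_2$ matrix functions contractive on $\mathbb{C}_-$; for such perturbed triples the same construction yields $\widetilde A,\widetilde S_k,\widetilde C_k,\dots$. *)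

(* Defs.v *)
From mathcomp Require Import all_boot all_order all_algebra.
From mathcomp Require Import reals.
From mathcomp.real_closed Require Export complex.
Set Implicit Arguments. Unset Strict Implicit. Unset Printing Implicit Defensive.
Import GRing.Theory Num.Theory.
Local Open Scope ring_scope.

Section Defs.
Variable R : realType.
Local Notation C := (R[i]).

Definition cR (r : R) : C := real_complex R r.

Definition adjmx p q (M : 'M[C]_(p, q)) : 'M[C]_(q, p) := (map_mx Num.conj M)^T.

(* a norm on matrices (entrywise l^1 norm); all norms on a finite-dimensional
   space are equivalent, so the stability statement does not depend on it *)
Definition mxnorm p q (M : 'M[C]_(p, q)) : C := \sum_i \sum_j `|M i j|.

Definition qform p (M : 'M[C]_p) (v : 'cV[C]_p) : C := (adjmx v *m M *m v) 0 0.

Definition hermitian p (M : 'M[C]_p) := adjmx M = M.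

Definition posdef p (M : 'M[C]_p) :=
  hermitian M /\ forall v : 'cV[C]_p, v != 0 -> 0 < qform M v.

Definition transfer n m1 m2 (A : 'M[C]_n) (B : 'M[C]_(n, m2)) (Cm : 'M[C]_(m1, n))
  (z : C) : 'M[C]_(m1, m2) := Cm *m invmx (z%:M - A) *m B.

Definition minimal_realization n m1 m2 (A : 'M[C]_n) (B : 'M[C]_(n, m2))
  (Cm : 'M[C]_(m1, n)) :=
  forall p, (p < n)%N -> ~ exists (A' : 'M[C]_p) (B' : 'M[C]_(p, m2)) (C' : 'M[C]_(m1, p)),
    forall z : C, (z%:M - A) \in unitmx -> (z%:M - A') \in unitmx ->
      transfer A' B' C' z = transfer A B Cm z.

Definition contractive_lower n m1 m2 (A : 'M[C]_n) (B : 'M[C]_(n, m2))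
  (Cm : 'M[C]_(m1, n)) :=
  forall z : C, 'Im z < 0 ->
    (z%:M - A) \in unitmx /\
    forall v : 'cV[C]_m2, qform 1%:M (transfer A B Cm z *m v) <= qform 1%:M v.

Definition in_Gn n m1 m2 (A : 'M[C]_n) (B : 'M[C]_(n, m2)) (Cm : 'M[C]_(m1, n)) :=
  minimal_realization A B Cm /\ contractive_lower A B Cm.

Definition riccati_sol n m1 m2 (A : 'M[C]_n) (B : 'M[C]_(n, m2)) (Cm : 'M[C]_(m1, n))
  (X : 'M[C]_n) :=
  [/\ posdef X,
      X *m B *m adjmx B *m X - 'i *: (adjmx A *m X - X *m A) + adjmx Cm *m Cm = 0
    & forall a : C, eigenvalue (A - 'i *: (B *m adjmx B *m X)) a -> 0 <= 'Im a].

Definition jmx m1 m2 : 'M[C]_(m1 + m2) := block_mx 1%:M 0 0 (- 1%:M).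

Section Procedure.
Variables (n m1 m2 : nat) (Am : 'M[C]_n) (B : 'M[C]_(n, m2)) (Cm : 'M[C]_(m1, n))
  (X : 'M[C]_n).

Definition Aproc : 'M[C]_n := Am - 'i *: (B *m adjmx B *m X).
Definition Ainv : 'M[C]_n := invmx Aproc.
Definition Pi0 : 'M[C]_(n, m1 + m2) := row_mx ('i *: (invmx X *m adjmx Cm)) B.

Fixpoint PiS (k : nat) : 'M[C]_(n, m1 + m2) :=
  match k with
  | 0 => Pi0
  | k.+1 => PiS k + 'i *: (Ainv *m PiS k *m jmx m1 m2)
  end.

Fixpoint SS (k : nat) : 'M[C]_n :=
  match k with
  | 0 => invmx X
  | k.+1 => SS k + Ainv *m SS k *m adjmx Ainv
              + Ainv *m PiS k *m adjmx (PiS k) *m adjmx Ainv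
  end.

Definition Cpot (k : nat) : 'M[C]_(m1 + m2) :=
  1%:M + adjmx (PiS k) *m invmx (SS k) *m PiS k
       - adjmx (PiS k.+1) *m invmx (SS k.+1) *m PiS k.+1.

Definition Rseq (r : nat) : 'M[C]_n :=
  invmx ((1%:M + 'i *: Ainv) ^+ r) *m SS r
    *m invmx ((1%:M - 'i *: invmx (adjmx Aproc)) ^+ r).

Definition Qseq (r : nat) : 'M[C]_n :=
  invmx ((1%:M - 'i *: Ainv) ^+ r) *m SS r
    *m invmx ((1%:M + 'i *: invmx (adjmx Aproc)) ^+ r).

End Procedure.

Definition mx_tends_to_infty p (M : nat -> 'M[C]_p) :=
  forall K : R, exists N : nat, forall k, (N <= k)%N ->
    forall a : C, eigenvalue (M k) a -> cR K <= a.

End Defs.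

(* Main.v *)
From mathcomp Require Import all_boot all_order all_algebra.
From mathcomp Require Import boolp classical_sets filter reals topology normedtype.
From mathcomp Require Import ring interval_inference.
From mathcomp.real_closed Require Import complex.
Require Import Defs.
Import Order.TTheory GRing.Theory Num.Theory.
Import numFieldNormedType.Exports.
Set Implicit Arguments. Unset Strict Implicit. Unset Printing Implicit Defensive.
Local Open Scope ring_scope.

(** Nothing can be said about the norm of a perturbed Riccati solution [X'] a priori, so its
    convergence to [X] is obtained by compactness along an ultrafilter.  The spectral
    condition bounds [tr (B'^* X' B')] by [Im (tr A')]; if [X'] were unbounded, a limit of
    [X' / tr X'] would therefore be a nonzero matrix whose kernel is invariant under the
    state matrix and contains the range of [B], against controllability.  A finite limit
    solves the limit equation with spectrum in the closed upper half-plane (a closed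
    condition, since [|det (z - A')| >= |Im z|^n] for [Im z < 0]), and controllability makes
    such a solution unique, so it is [X].  This gives convergence of each [C_k].

    Uniformity in [k] comes from monotonicity.  Let [Y_k] be one of the two column blocks of
    [Pi_k], the first for [R_k], the second for [Q_k].  Then [g_k = Y_k^* S_k^-1 Y_k] is
    nonincreasing and the corresponding diagonal block of [C_k] is [1 + g_k - g_(k+1)], so
    for all [k >= N] it is within [tr g_N] of the identity.  As [C_k >= 0] and
    [C_k j C_k = j], the other blocks are then close to those of the identity as well.
    Writing [g_N = Y_0^* R_N^-1 Y_0] (resp. [Q_N]), the assumption makes [tr g_N] small for
    one [N], and it stays small under perturbation because only finitely many steps are
    involved. *)

(** * Adjoints and positive semidefinite matrices *)

(* Over [R[i]], this is convertible to [adjmx], and likewise [qf], [pd], [signature] and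
   [closed_loop] below are convertible to their counterparts in [Defs]. *)
Definition adj (C : numClosedFieldType) p q (M : 'M[C]_(p, q)) : 'M[C]_(q, p) :=
  (map_mx Num.conj M)^T.
Local Notation "M ^H" := (adj M) (at level 8, format "M ^H").

(* [ring] knows no noncommutative rings: the matrix monomials are generalized to atoms first. *)
Ltac mx_abelian :=
  repeat match goal with |- context [mulmx ?a ?b] => move: (mulmx a b) => ? end;
  let i := fresh in let j := fresh in
  apply/matrixP => i j; rewrite !mxE; ring.

Lemma mulZmx (F : comPzRingType) p q r a (M : 'M[F]_(p, q)) (N : 'M[F]_(q, r)) :
  (a *: M) *m N = a *: (M *m N).
Proof. by rewrite scalemxAl. Qed.

Lemma mulmxZ (F : comPzRingType) p q r a (M : 'M[F]_(p, q)) (N : 'M[F]_(q, r)) :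
  M *m (a *: N) = a *: (M *m N).
Proof. by rewrite scalemxAr. Qed.

Ltac mx_expand :=
  rewrite ?(mulmxDl, mulmxDr, mulNmx, mulmxN, mulZmx, mulmxZ, mul1mx, mulmx1, mulmxA,
            scalerDr, scalerN, scaleNr, scalerA).

Section Adjoint.
Variable C : numClosedFieldType.

Lemma adjK p q (M : 'M[C]_(p, q)) : M^H^H = M.
Proof. by apply/matrixP => i j; rewrite !mxE conjCK. Qed.

Lemma adjD p q (M N : 'M[C]_(p, q)) : (M + N)^H = M^H + N^H.
Proof. by apply/matrixP => i j; rewrite !mxE rmorphD. Qed.

Lemma adjN p q (M : 'M[C]_(p, q)) : (- M)^H = - M^H.
Proof. by apply/matrixP => i j; rewrite !mxE rmorphN. Qed.

Lemma adjB p q (M N : 'M[C]_(p, q)) : (M - N)^H = M^H - N^H.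
Proof. by rewrite adjD adjN. Qed.

Lemma adjZ p q a (M : 'M[C]_(p, q)) : (a *: M)^H = a^* *: M^H.
Proof. by apply/matrixP => i j; rewrite !mxE rmorphM. Qed.

Lemma adjM p q r (M : 'M[C]_(p, q)) (N : 'M[C]_(q, r)) :
  (M *m N)^H = N^H *m M^H.
Proof. by rewrite /adj map_mxM trmx_mul. Qed.

Lemma adj0 p q : (0 : 'M[C]_(p, q))^H = 0.
Proof. by apply/matrixP => i j; rewrite !mxE rmorph0. Qed.

Lemma adj_scalar p (a : C) : (a%:M : 'M[C]_p)^H = a^*%:M.
Proof. by rewrite /adj map_scalar_mx tr_scalar_mx. Qed.

Lemma adj1 p : (1%:M : 'M[C]_p)^H = 1%:M.
Proof. by rewrite adj_scalar rmorph1. Qed.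

Lemma adj_inv p (M : 'M[C]_p) : (invmx M)^H = invmx M^H.
Proof. by rewrite /adj map_invmx trmx_inv. Qed.

Lemma unitmx_adj p (M : 'M[C]_p) : (M^H \in unitmx) = (M \in unitmx).
Proof. by rewrite /adj unitmx_tr map_unitmx. Qed.

Lemma adj_row p q1 q2 (M : 'M[C]_(p, q1)) (N : 'M[C]_(p, q2)) :
  (row_mx M N)^H = col_mx M^H N^H.
Proof. by rewrite /adj map_row_mx tr_row_mx. Qed.

Lemma adj_col p1 p2 q (M : 'M[C]_(p1, q)) (N : 'M[C]_(p2, q)) :
  (col_mx M N)^H = row_mx M^H N^H.
Proof. by rewrite /adj map_col_mx tr_col_mx. Qed.

Lemma adj_block p1 p2 q1 q2 (Mul : 'M[C]_(p1, q1)) (Mur : 'M[C]_(p1, q2))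
    (Mdl : 'M[C]_(p2, q1)) (Mdr : 'M[C]_(p2, q2)) :
  (block_mx Mul Mur Mdl Mdr)^H = block_mx Mul^H Mdl^H Mur^H Mdr^H.
Proof. by rewrite /adj map_block_mx tr_block_mx. Qed.

Lemma adj_exp p (M : 'M[C]_p) r : (M ^+ r)^H = M^H ^+ r.
Proof.
elim: r => [|r IHr]; first by rewrite !expr0 adj1.
by rewrite exprS adjM IHr exprSr.
Qed.

Lemma scaleii p q (M : 'M[C]_(p, q)) : 'i *: ('i *: M) = - M.
Proof. by rewrite scalerA -expr2 sqrCi scaleN1r. Qed.

Definition frob p q (M : 'M[C]_(p, q)) : C := \tr (M *m M^H).

Lemma frobE p q (M : 'M[C]_(p, q)) : frob M = \sum_i \sum_j `|M i j| ^+ 2.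
Proof.
rewrite /frob /mxtrace; apply: eq_bigr => i _; rewrite mxE.
by apply: eq_bigr => j _; rewrite !mxE -normCK.
Qed.

Lemma frob_ge0 p q (M : 'M[C]_(p, q)) : 0 <= frob M.
Proof. by rewrite frobE !sumr_ge0 // => i _; rewrite sumr_ge0 // => j _; rewrite exprn_ge0. Qed.

Lemma frob_adj p q (M : 'M[C]_(p, q)) : frob M^H = frob M.
Proof. by rewrite /frob adjK mxtrace_mulC. Qed.

Lemma frob_entry p q (M : 'M[C]_(p, q)) i j : `|M i j| ^+ 2 <= frob M.
Proof.
rewrite frobE (bigD1 i) //= (bigD1 j) //= -addrA lerDl addr_ge0 //.
  by rewrite sumr_ge0 // => k _; rewrite exprn_ge0.
by rewrite sumr_ge0 // => k _; rewrite sumr_ge0 // => l _; rewrite exprn_ge0.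
Qed.

Lemma frob_eq0 p q (M : 'M[C]_(p, q)) : (frob M == 0) = (M == 0).
Proof.
apply/eqP/eqP => [M0|->]; last by rewrite /frob mul0mx mxtrace0.
apply/matrixP => i j; rewrite mxE; apply/eqP; rewrite -normr_eq0 -sqrf_eq0.
by rewrite eq_le exprn_ge0 // andbT -M0 frob_entry.
Qed.

End Adjoint.

(** The assumed expression is $c-2t|b|^2+t^2|b|^2a$. For $a\neq0$ its value at $t=1/a$ gives the
    claim; for $a=0$ it is affine in $t$, which forces $b=0$. *)
Lemma discriminant_le (K : numClosedFieldType) (a b c : K) : 0 <= a -> 0 <= c ->
  (forall t, t \is Num.real -> 0 <= c - t * b * b^* - t * b^* * (b - t * b * a)) ->
  `|b| ^+ 2 <= a * c.
Proof.
move=> a0 c0 expand.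
have b0 : 0 <= `|b| ^+ 2 by rewrite exprn_ge0.
have [a_eq0|a_neq0] := eqVneq a 0.
  rewrite a_eq0 mul0r; have [-> //|bn0] := eqVneq (`|b| ^+ 2) 0.
  (* At this $t$ the affine expression equals $-(c+2)<0$. *)
  have tR : (c + 1) / `|b| ^+ 2 \is Num.real.
    by rewrite realM ?realV ?realD ?ger0_real.
  move: (expand _ tR); rewrite a_eq0 mulr0 subr0 -!mulrA [b^* * b]mulrC -normCK.
  rewrite mulVf // mulr1 => h.
  have h2 : c - (c + 1) - (c + 1) = - (c + 2) by ring.
  rewrite h2 oppr_ge0 in h.
  by have := lt_le_trans (ltr_wpDl c0 (ltr0n K 2)) h; rewrite ltxx.
have aR : a^-1 \is Num.real by rewrite realV ger0_real.
have := mulr_ge0 a0 (expand _ aR).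
have -> : a * (c - a^-1 * b * b^* - a^-1 * b^* * (b - a^-1 * b * a)) = a * c - b * b^*.
  by field.
by rewrite subr_ge0 -normCK.
Qed.

Section Psd.
Variable C : numClosedFieldType.

Definition qf p (M : 'M[C]_p) (v : 'cV[C]_p) : C := (v^H *m M *m v) 0 0.

Definition herm p (M : 'M[C]_p) := M^H = M.

Definition pd p (M : 'M[C]_p) := herm M /\ forall v : 'cV[C]_p, v != 0 -> 0 < qf M v.

Definition psd p (M : 'M[C]_p) := herm M /\ forall v : 'cV[C]_p, 0 <= qf M v.

Lemma qfE p (M : 'M[C]_p) v : qf M v = \tr (v^H *m M *m v).
Proof. by rewrite /qf /mxtrace big_ord1. Qed.

Lemma qfD p (M N : 'M[C]_p) v : qf (M + N) v = qf M v + qf N v.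
Proof. by rewrite !qfE mulmxDr mulmxDl raddfD. Qed.

Lemma qf_congr p q (M : 'M[C]_p) (N : 'M[C]_(p, q)) v :
  qf (N^H *m M *m N) v = qf M (N *m v).
Proof. by rewrite !qfE adjM !mulmxA. Qed.

Lemma pd_psd p (M : 'M[C]_p) : pd M -> psd M.
Proof.
case=> hM M_gt0; split=> // v; have [->|/M_gt0/ltW//] := eqVneq v 0.
by rewrite qfE mulmx0 mxtrace0.
Qed.

Lemma psdD p (M N : 'M[C]_p) : psd M -> psd N -> psd (M + N).
Proof.
move=> [hM M_ge0] [hN N_ge0]; split; first by rewrite /herm adjD hM hN.
by move=> v; rewrite qfD addr_ge0.
Qed.

Lemma pdD p (M N : 'M[C]_p) : pd M -> psd N -> pd (M + N).
Proof.
move=> [hM M_gt0] [hN N_ge0]; split; first by rewrite /herm adjD hM hN.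
by move=> v v0; rewrite qfD ltr_wpDr // M_gt0.
Qed.

Lemma psd_congr p q (M : 'M[C]_p) (N : 'M[C]_(p, q)) :
  psd M -> psd (N^H *m M *m N).
Proof.
move=> [hM M_ge0]; split; last by move=> v; rewrite qf_congr.
by rewrite /herm !adjM adjK hM mulmxA.
Qed.

Lemma qf1 p (v : 'cV[C]_p) : qf 1%:M v = frob v.
Proof. by rewrite qfE mulmx1 mxtrace_mulC. Qed.

Lemma psd_gram p q (N : 'M[C]_(p, q)) : psd (N^H *m N).
Proof.
rewrite -[N^H]mulmx1; apply: psd_congr; split; first exact: adj1.
by move=> v; rewrite qf1 frob_ge0.
Qed.

Lemma psd1 p : psd (1%:M : 'M[C]_p).
Proof. by rewrite -[1%:M]mulmx1 -{1}adj1; apply: psd_gram. Qed.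

Lemma psdZ p (a : C) (M : 'M[C]_p) : 0 <= a -> psd M -> psd (a *: M).
Proof.
move=> a0 [hM M_ge0]; split.
  by rewrite /herm adjZ hM (CrealP _) // ger0_real.
move=> v; rewrite qfE -scalemxAr -scalemxAl mxtraceZ -qfE.
exact: mulr_ge0.
Qed.

Lemma qf_delta p (M : 'M[C]_p) i : qf M (delta_mx i 0) = M i i.
Proof.
rewrite /qf mxE (bigD1 i) //= big1 ?addr0 => [|k /negPf ki]; last first.
  by rewrite !mxE ki /= mulr0.
rewrite !mxE !eqxx mulr1 (bigD1 i) //= big1 ?addr0 => [|k /negPf ki]; last first.
  by rewrite !mxE ki rmorph0 mul0r.
by rewrite !mxE !eqxx rmorph1 mul1r.
Qed.

Lemma psd_diag p (M : 'M[C]_p) i : psd M -> 0 <= M i i.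
Proof. by case=> _ /(_ (delta_mx i 0)); rewrite qf_delta. Qed.

Lemma psd_tr p (M : 'M[C]_p) : psd M -> 0 <= \tr M.
Proof. by move=> psdM; rewrite sumr_ge0 // => i _; apply: psd_diag. Qed.

Lemma mxtraceB p (M N : 'M[C]_p) : \tr (M - N) = \tr M - \tr N.
Proof. by rewrite mxtraceD -scaleN1r mxtraceZ mulN1r. Qed.

(** With $b=u^*Mv$, positivity of the form at $v-tbu$ for real $t$ is the hypothesis of
    [discriminant_le], which covers a degenerate form as well. *)
Lemma psd_cauchy_schwarz p (M : 'M[C]_p) (u v : 'cV[C]_p) : psd M ->
  `|\tr (u^H *m M *m v)| ^+ 2 <= qf M u * qf M v.
Proof.
move=> [hM M_ge0]; apply: discriminant_le => // t tR.
have := M_ge0 (v - (t * \tr (u^H *m M *m v)) *: u).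
rewrite qfE adjB adjZ.
set b := \tr (u^H *m M *m v).
have eb : b^* = \tr (v^H *m M *m u).
  have -> : v^H *m M *m u = (u^H *m M *m v)^H by rewrite !adjM adjK hM mulmxA.
  by rewrite /b /mxtrace !big_ord1 !mxE.
have -> : (t * b)^* = t * b^* by rewrite rmorphM /= (CrealP tR).
rewrite eb.
rewrite mulmxBl -scalemxAl mulmxBl -scalemxAl !mulmxBr -!scalemxAr.
by rewrite !mxtraceB !mxtraceZ mxtraceB mxtraceZ -!qfE.
Qed.

Lemma psd_entry p (M : 'M[C]_p) i j : psd M -> `|M i j| ^+ 2 <= M i i * M j j.
Proof.
move=> psdM; rewrite -!qf_delta.
suff <- : \tr ((delta_mx i 0 : 'cV[C]_p)^H *m M *m (delta_mx j 0)) = M i j.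
  exact: psd_cauchy_schwarz.
rewrite /mxtrace big_ord1 mxE (bigD1 j) //= big1 ?addr0 => [|k /negPf ki]; last first.
  by rewrite !mxE ki /= mulr0.
rewrite !mxE !eqxx mulr1 (bigD1 i) //= big1 ?addr0 => [|k /negPf ki]; last first.
  by rewrite !mxE ki rmorph0 mul0r.
by rewrite !mxE !eqxx rmorph1 mul1r.
Qed.

(** Sum $|M_{il}|^2\le M_{ii}M_{ll}$ over all entries. The trace thereby controls every entry, both
    for compactness and for smallness. *)
Lemma psd_frob p (M : 'M[C]_p) : psd M -> frob M <= (\tr M) ^+ 2.
Proof.
move=> psdM; rewrite frobE expr2 {1}/mxtrace mulr_suml ler_sum // => i _.
by rewrite /mxtrace mulr_sumr ler_sum // => j _; apply: psd_entry.
Qed.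

Lemma pd_unit p (M : 'M[C]_p) : pd M -> M \in unitmx.
Proof.
case=> hM M_gt0; rewrite -unitmx_tr -row_free_unit -kermx_eq0.
apply/negPn/negP => /rowV0Pn[w /sub_kermxP wM w0].
have := M_gt0 w^T; rewrite trmx_eq0 => /(_ w0).
rewrite qfE -mulmxA -[M]trmxK -trmx_mul wM trmx0 mulmx0 mxtrace0.
by rewrite ltxx.
Qed.

Lemma pd_inv p (M : 'M[C]_p) : pd M -> pd (invmx M).
Proof.
move=> pM; have uM := pd_unit pM; case: pM => hM M_gt0.
have hi : herm (invmx M) by rewrite /herm adj_inv hM.
split=> // v v0; rewrite -[invmx M](mulmxK uM) -[X in X *m M]hi qf_congr M_gt0 //.
by apply: contra_neq v0 => /(congr1 (mulmx M)); rewrite mulKVmx // mulmx0.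
Qed.

(* Completing the square: the matrix is
   (q - W^* g)^* S (q - W^* g) + g^* (S' - W S W^* ) g with g = S'^-1 W S q. *)
Lemma psd_square p p' r (S : 'M[C]_p) (S' : 'M[C]_p') (W : 'M[C]_(p', p)) (q : 'M[C]_(p, r)) :
  psd S -> pd S' -> psd (S' - W *m S *m W^H) ->
  psd (q^H *m S *m q - (W *m S *m q)^H *m invmx S' *m (W *m S *m q)).
Proof.
move=> pS pS' pD; have uS' := pd_unit pS'; have [hS' _] := pS'; have [hS _] := pS.
have [g gE S'g] : exists2 g, invmx S' *m (W *m S *m q) = g & S' *m g = W *m S *m q.
  by eexists; [reflexivity | rewrite mulKVmx].
have -> : q^H *m S *m q - (W *m S *m q)^H *m invmx S' *m (W *m S *m q)
   = (q - W^H *m g)^H *m S *m (q - W^H *m g) + g^H *m (S' - W *m S *m W^H) *m g.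
  have e1 : q^H *m (S *m (W^H *m g)) = g^H *m (S' *m g).
    by have := congr1 (@adj C _ _) S'g; rewrite !adjM hS hS' !mulmxA => ->.
  rewrite -[_ *m invmx S' *m _]mulmxA gE -S'g adjB !adjM adjK hS'.
  rewrite !mulmxBl !mulmxBr !mulmxBl -!mulmxA e1 S'g -!mulmxA.
  mx_abelian.
by apply: psdD; apply: psd_congr.
Qed.

(** Cauchy-Schwarz for the pair $Mv$, $v$ bounds $\|Mv\|^4$ by a multiple of $v^*Mv$. *)
Lemma psd_kernel p (M : 'M[C]_p) v : psd M -> qf M v = 0 -> M *m v = 0.
Proof.
move=> pM Mv0; apply/eqP; rewrite -frob_eq0 -frob_adj /frob adjK mulmxA.
have := psd_cauchy_schwarz (M *m v) v pM; rewrite Mv0 mulr0 => h.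
by rewrite -normr_eq0 -sqrf_eq0 eq_le h exprn_ge0.
Qed.

End Psd.

(** * One step of the recursion *)

Section Step.
Variable C : numClosedFieldType.
Variables (n m : nat) (A T S S' : 'M[C]_n) (P P' : 'M[C]_(n, m)) (j : 'M[C]_m).
Hypothesis TA : T *m A = 1%:M.
Hypothesis defP' : P' = P + 'i *: (T *m P *m j).
Hypothesis defS' : S' = S + T *m S *m T^H + T *m P *m P^H *m T^H.
Hypothesis ASj : A *m S - S *m A^H = 'i *: (P *m j *m P^H).
Hypothesis hj : j^H = j.
Hypothesis jj : j *m j = 1%:M.
Hypothesis pS : pd S.

Let hS : S^H = S. Proof. by case: pS. Qed.
Let AT : A *m T = 1%:M. Proof. exact: mulmx1C. Qed.
Let THAH : T^H *m A^H = 1%:M. Proof. by rewrite -adjM AT adj1. Qed.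
Let AHTH : A^H *m T^H = 1%:M. Proof. by rewrite -adjM TA adj1. Qed.

Let STTS : S *m T^H - T *m S = 'i *: (T *m P *m j *m P^H *m T^H).
Proof.
have := congr1 (fun M => T *m M *m T^H) ASj.
rewrite mulmxBr mulmxBl !mulmxA TA mul1mx -!mulmxA AHTH mulmx1 => ->.
by rewrite -!scalemxAl -scalemxAr -!mulmxA.
Qed.

Lemma adj_step : P'^H = P^H - 'i *: (j *m P^H *m T^H).
Proof. by rewrite defP' adjD adjZ conjCi !adjM hj scaleNr -!mulmxA. Qed.

Lemma step_pd : pd S'.
Proof.
rewrite defS' -addrA; apply: pdD => //; apply: psdD.
  by rewrite -{1}[T]adjK; apply: psd_congr; apply: pd_psd.
rewrite -[T *m P *m P^H *m T^H]mulmxA -adjM -{1}[T *m P]adjK; exact: psd_gram.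
Qed.

(** The recursion preserves the displacement identity [ASj]. The identities [STTS'] and [ASj'] bring
    all monomials to a common order, after which the terms cancel additively. *)
Lemma step_displacement : A *m S' - S' *m A^H = 'i *: (P' *m j *m P'^H).
Proof.
rewrite adj_step defP' defS'.
have STTS' : S *m T^H = T *m S + 'i *: (T *m P *m j *m P^H *m T^H).
  by rewrite -STTS addrC subrK.
have ASj' : A *m S = S *m A^H + 'i *: (P *m j *m P^H).
  by rewrite -ASj addrC subrK.
rewrite !mulmxDr !mulmxDl !mulmxN !mulmxA AT !mul1mx.
rewrite -!(mulmxA _ T^H A^H) THAH !mulmx1 -!scalemxAr -?scalemxAl.
rewrite !scalerDr !scalerN -?scalemxAl !scaleii !mulmxA.
rewrite -[T *m P *m j *m j]mulmxA -[P *m j *m j]mulmxA jj !mulmx1.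
rewrite STTS' ASj'.
mx_abelian.
Qed.

(* For j e = s e with s = 1 or -1, multiplying by 1 + s i T propagates the block P e. *)
Lemma step_order s : s^* = s -> s * s = 1 ->
  psd (S' - (1%:M + (s * 'i) *: T) *m S *m (1%:M + (s * 'i) *: T)^H).
Proof.
move=> sR ss.
have STTS' : S *m T^H = T *m S + 'i *: (T *m P *m j *m P^H *m T^H).
  by rewrite -STTS addrC subrK.
(* By [STTS] the difference is $TP(1-sj)P^*T^*$. Since $(sj)^2=1$, one has $1-sj=\frac12(1-sj)^2$,
   so this is a Gram matrix. *)
have -> : S' - (1%:M + (s * 'i) *: T) *m S *m (1%:M + (s * 'i) *: T)^H
   = 2^-1 *: ((T *m P *m (1%:M - s *: j)) *m (T *m P *m (1%:M - s *: j))^H).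
  rewrite !adjM adjD adjB !adjZ !adj1 hj [(s * 'i)^*]rmorphM /= sR conjCi defS'.
  mx_expand; rewrite STTS'; mx_expand.
  have ii : 'i * 'i = -1 :> C by rewrite -expr2 sqrCi.
  have -> : s * - 'i * 'i = s by rewrite -mulrA mulNr ii opprK mulr1.
  have -> : s * 'i * (s * - 'i) = 1 by rewrite mulrACA ss mulrN ii opprK mulr1.
  rewrite -[2^-1 * s * s]mulrA ss -[T *m P *m j *m j]mulmxA jj !mulmx1 scale1r mulr1.
  repeat match goal with |- context [mulmx ?a ?b] => move: (mulmx a b) => ? end.
  by apply/matrixP => k l; rewrite !mxE; field.
apply: psdZ; first by rewrite invr_ge0 ler0n.
by rewrite -{1}[T *m P *m _]adjK; apply: psd_gram.
Qed.

Definition step_potential := 1%:M + P^H *m invmx S *m P - P'^H *m invmx S' *m P'.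

(** Completing the square with $D=\mathrm{diag}(S,1)$, $W=[1\ \ TP]$ and
    $q=[S^{-1}P;\ \mathrm{i}j]$: then $WDq=P'$, $q^*Dq=1+P^*S^{-1}P$ and $S'-WDW^*=TST^*\ge0$. *)
Lemma step_potential_psd : psd step_potential.
Proof.
have uS := pd_unit pS; have pS' := step_pd; have [hS' _] := pS'.
pose D := block_mx S 0 0 1%:M : 'M[C]_(n + m).
pose W := row_mx 1%:M (T *m P).
pose q := col_mx (invmx S *m P) ('i *: j).
have WDq : W *m D *m q = P'.
  rewrite /W /D /q mul_row_block !mulmx0 add0r addr0 mul1mx mulmx1 mul_row_col.
  by rewrite mulKVmx // defP' mulmxZ -!mulmxA.
have psdD' : psd D.
  split=> [|v]; first by rewrite /herm /D adj_block !adj0 adj1 hS.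
  rewrite -[v]vsubmxK qfE adj_col mul_row_block !mulmx0 add0r addr0 mulmx1 mul_row_col.
  rewrite mxtraceD addr_ge0 //; first by rewrite -qfE; case: (pd_psd pS).
  by rewrite mxtrace_mulC frob_ge0.
have := psd_square (W := W) q psdD' pS'; rewrite WDq => /(_ _).
have -> : q^H *m D *m q = 1%:M + P^H *m invmx S *m P.
  rewrite /q /D adj_col mul_row_block !mulmx0 add0r addr0 mulmx1 mul_row_col.
  rewrite adjM adj_inv hS mulmxKV // adjZ hj conjCi mulZmx mulmxZ jj scalerA.
  by rewrite mulNr -expr2 sqrCi opprK scale1r addrC mulmxA.
apply.
have -> : W *m D *m W^H = S + T *m P *m P^H *m T^H.
  rewrite /W /D mul_row_block !mulmx0 add0r addr0 mul1mx mulmx1 adj_row adj1 mul_row_col.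
  by rewrite mulmx1 adjM !mulmxA.
rewrite defS' (_ : _ - _ = T *m S *m T^H); last by mx_abelian.
by rewrite -{1}[T]adjK; apply: psd_congr; apply: pd_psd.
Qed.

(** The displacement identities turn each of the four products of [P], [P'] around [j] into an
    expression linear in [S] or [S']. These cancel against the inverses in [a] and [a'], and the
    remaining terms sum to zero. *)
Lemma step_potential_unitary : step_potential *m j *m step_potential = j.
Proof.
have pS' := step_pd; have uS := pd_unit pS; have uS' := pd_unit pS'.
have hS' : S'^H = S' by case: pS'.
pose a := P^H *m invmx S; pose a' := P'^H *m invmx S'.
have aS : a *m S = P^H by rewrite mulmxKV.
have a'S' : a' *m S' = P'^H by rewrite mulmxKV.
have Sa : S *m a^H = P by rewrite -{1}hS -adjM aS adjK.
have S'a' : S' *m a'^H = P' by rewrite -{1}hS' -adjM a'S' adjK.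
(* Using one form for the left factor and the other for the right one places [j] between [P] or [P']
   and an adjoint of these. *)
have UE : step_potential = 1%:M + a *m P - a' *m P' by [].
have UE' : step_potential = 1%:M + P^H *m a^H - P'^H *m a'^H.
  by rewrite UE -aS -a'S' -[a *m S *m _]mulmxA -[a' *m S' *m _]mulmxA Sa S'a'.
have nii p q (M : 'M[C]_(p, q)) : M = - 'i *: ('i *: M).
  by rewrite scaleNr scaleii opprK.
have E1 : P *m j *m P^H = - 'i *: (A *m S - S *m A^H) by rewrite ASj -nii.
have E2 : P' *m j *m P'^H = - 'i *: (A *m S' - S' *m A^H) by rewrite step_displacement -nii.
have AS'AH : A *m S' = A *m S + S *m T^H + P *m P^H *m T^H.
  by rewrite defS'; mx_expand; rewrite AT !mul1mx.
have E3 : P *m j *m P'^H = - 'i *: (A *m S' - S *m A^H - S *m T^H).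
  rewrite AS'AH adj_step; mx_expand; rewrite -[P *m j *m j]mulmxA jj mulmx1 E1.
  mx_expand; mx_abelian.
have E4 : P' *m j *m P^H = 'i *: (S' *m A^H - A *m S - T *m S).
  have := congr1 (@adj C _ _) E3; rewrite adjZ !adjB !adjM !adjK hj hS hS' raddfN /= conjCi.
  by rewrite opprK !mulmxA.
have AP' : A *m P' = A *m P + 'i *: (P *m j).
  by rewrite defP'; mx_expand; rewrite AT mul1mx.
have P'A : P'^H *m A^H = P^H *m A^H - 'i *: (j *m P^H).
  by rewrite -adjM AP' adjD adjZ !adjM hj conjCi scaleNr.
have P'j : P' *m j = P *m j + 'i *: (T *m P).
  by rewrite defP'; mx_expand; rewrite -[T *m P *m j *m j]mulmxA jj mulmx1.
have jP' : j *m P'^H = j *m P^H - 'i *: (P^H *m T^H).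
  by rewrite adj_step; mx_expand; rewrite jj mul1mx.
have F1 : a *m P *m j *m P^H *m a^H = - 'i *: (a *m A *m P - P^H *m A^H *m a^H).
  have -> : a *m P *m j *m P^H *m a^H = a *m (P *m j *m P^H) *m a^H by rewrite !mulmxA.
  by rewrite E1 mulmxZ mulZmx mulmxBr mulmxBl !mulmxA aS -(mulmxA _ S) Sa.
have F2 : a' *m P' *m j *m P'^H *m a'^H = - 'i *: (a' *m A *m P' - P'^H *m A^H *m a'^H).
  have -> : a' *m P' *m j *m P'^H *m a'^H = a' *m (P' *m j *m P'^H) *m a'^H.
    by rewrite !mulmxA.
  by rewrite E2 mulmxZ mulZmx mulmxBr mulmxBl !mulmxA a'S' -(mulmxA _ S') S'a'.
have F3 : a *m P *m j *m P'^H *m a'^H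
    = - 'i *: (a *m A *m P' - P^H *m A^H *m a'^H - P^H *m T^H *m a'^H).
  have -> : a *m P *m j *m P'^H *m a'^H = a *m (P *m j *m P'^H) *m a'^H.
    by rewrite !mulmxA.
  by rewrite E3 mulmxZ mulZmx !mulmxBr !mulmxBl !mulmxA aS -(mulmxA _ S') S'a'.
have F4 : a' *m P' *m j *m P^H *m a^H
    = 'i *: (P'^H *m A^H *m a^H - a' *m A *m P - a' *m T *m P).
  have -> : a' *m P' *m j *m P^H *m a^H = a' *m (P' *m j *m P^H) *m a^H.
    by rewrite !mulmxA.
  by rewrite E4 mulmxZ mulZmx !mulmxBr !mulmxBl !mulmxA a'S' -!(mulmxA _ S) Sa.
rewrite {1}UE UE'; mx_expand; rewrite F1 F2 F3 F4.
rewrite -[a' *m P' *m j]mulmxA P'j jP' -[a *m A *m P']mulmxA -[a' *m A *m P']mulmxA AP' P'A.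
mx_expand; rewrite -?['i * 'i]expr2 sqrCi.
have ii : 'i * 'i = -1 :> C by rewrite -expr2 sqrCi.
repeat match goal with |- context [mulmx ?a ?b] => move: (mulmx a b) => ? end.
apply/matrixP => k l; rewrite !mxE; ring: ii.
Qed.
End Step.

(** * Potentials close to the identity *)

Section UnitaryPotential.
Variable C : numClosedFieldType.

Lemma frob_row p q1 q2 (M : 'M[C]_(p, q1)) (N : 'M[C]_(p, q2)) :
  frob (row_mx M N) = frob M + frob N.
Proof. by rewrite /frob adj_row mul_row_col mxtraceD. Qed.

Lemma frob_col p1 p2 q (M : 'M[C]_(p1, q)) (N : 'M[C]_(p2, q)) :
  frob (col_mx M N) = frob M + frob N.
Proof. by rewrite -frob_adj adj_col frob_row !frob_adj. Qed.

Lemma frob_unitary m p (U : 'M[C]_(m, p)) (M : 'M[C]_m) : U *m U^H = 1%:M ->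
  frob (U^H *m M *m U) = frob M.
Proof.
move=> UU; rewrite /frob !adjM adjK -!mulmxA (mulmxA U U^H) UU mul1mx.
by rewrite mxtrace_mulC -!mulmxA UU mulmx1.
Qed.

(** Both cross terms equal $\mathrm{tr}(D^*SD)\ge0$. For $D=S-1$ this bounds $D$ by $(S+1)D=S^2-1$
    without inverting $S+1$. *)
Lemma frob_psd_addl p q (S : 'M[C]_p) (D : 'M[C]_(p, q)) : psd S ->
  frob D <= frob (S *m D + D).
Proof.
move=> pS; have [hS _] := pS.
rewrite {2}/frob adjD mulmxDl !mulmxDr !mxtraceD -!/(frob _).
have t0 : 0 <= \tr (S *m D *m D^H).
  by rewrite -mulmxA mxtrace_mulC -mulmxA mxtrace_mulC; apply/psd_tr/psd_congr.
have t1 : \tr (D *m (S *m D)^H) = \tr (S *m D *m D^H).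
  by rewrite adjM hS mulmxA mxtrace_mulC mulmxA.
rewrite t1 addrA -[X in X <= _]add0r lerD2r.
by rewrite !addr_ge0 ?frob_ge0.
Qed.

(* In the block decomposition [P, G; G^*, S] given by e and f, the identity C j C = j says
   P^2 = 1 + G G^* and S^2 = 1 + G^* G, so the size of P - 1 controls that of C - 1. *)
Lemma unitary_potential_close m m1 m2 (e : 'M[C]_(m, m1)) (f : 'M[C]_(m, m2))
    (Cm : 'M[C]_m) (eta : C) :
  e^H *m e = 1%:M -> f^H *m f = 1%:M -> e *m e^H + f *m f^H = 1%:M ->
  psd Cm ->
  Cm *m (e *m e^H - f *m f^H) *m Cm = e *m e^H - f *m f^H ->
  psd (e^H *m Cm *m e - 1%:M) -> \tr (e^H *m Cm *m e - 1%:M) <= eta -> eta <= 1 ->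
  frob (Cm - 1%:M) <= 16%:R * eta.
Proof.
move=> ee ff eeff pC CjC pE trE eta1.
have [hC _] := pC.
have fe : f^H *m e = 0.
  have := congr1 (fun M => f^H *m (M *m e)) eeff.
  rewrite mulmxDl -!mulmxA ee mulmx1 mul1mx mulmxDr !mulmxA ff mul1mx => /eqP.
  by rewrite -subr_eq0 addrAC subrr add0r => /eqP.
have ef : e^H *m f = 0 by rewrite -[e^H *m f]adjK adjM adjK fe adj0.
pose P := e^H *m Cm *m e; pose G := e^H *m Cm *m f; pose S := f^H *m Cm *m f.
have GH : G^H = f^H *m Cm *m e by rewrite /G !adjM adjK hC mulmxA.
have PP : P *m P - G *m G^H = 1%:M.
  have := congr1 (fun M => e^H *m M *m e) CjC.
  mx_expand; rewrite ee ef mul1mx ee !mul0mx subr0 => <-.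
  by rewrite GH /P /G !mulmxA.
have SS : S *m S - G^H *m G = 1%:M.
  have := congr1 (fun M => f^H *m M *m f) CjC.
  mx_expand; rewrite fe ff !mul0mx mul1mx ff sub0r => h.
  by rewrite GH /S -opprB h opprK.
pose E := P - 1%:M; pose D := S - 1%:M.
have tE : 0 <= \tr E by apply: psd_tr.
have eta0 : 0 <= eta by apply: le_trans trE.
have etasq : eta ^+ 2 <= eta by rewrite expr2 ler_piMl.
have fE : frob E <= eta.
  apply: le_trans (psd_frob pE) _; apply: le_trans etasq.
  by rewrite ler_pXn2r // nnegrE.
have fG : frob G <= 3%:R * eta.
  have EH : E^H = E by case: pE.
  (* $GG^*=P^2-1=E^2+2E$ with $E=P-1$. *)
  have -> : frob G = frob E + 2 * \tr E.
    rewrite {2}/frob EH /frob (_ : G *m G^H = E *m E + 2%:R *: E).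
      by rewrite mxtraceD mxtraceZ.
    have -> : G *m G^H = P *m P - 1%:M by rewrite -PP subKr.
    rewrite /E mulmxBl !mulmxBr !mulmx1 mul1mx; mx_abelian.
  rewrite (_ : 3%:R * eta = eta + 2 * eta); last by ring.
  by rewrite lerD // ler_pM2l.
(* $(S+1)D=G^*G$, and the latter has Frobenius square at most
   $(\mathrm{tr}\,G^*G)^2\le(3\eta)^2\le9\eta$. *)
have fD : frob D <= 9%:R * eta.
  have pS : psd S by apply: psd_congr.
  apply: le_trans (frob_psd_addl D pS) _.
  have -> : S *m D + D = G^H *m G.
    have -> : G^H *m G = S *m S - 1%:M by rewrite -SS subKr.
    by rewrite /D mulmxBr mulmx1 addrA subrK.
  apply: le_trans (psd_frob (psd_gram G)) _.
  rewrite -[X in _ *m X]adjK -/(frob _) frob_adj.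
  apply: (le_trans (y := (3%:R * eta) ^+ 2)).
    by rewrite ler_pXn2r // nnegrE ?frob_ge0 // mulr_ge0.
  by rewrite exprMn -natrX ler_pM2l.
pose U := row_mx e f.
have UU : U *m U^H = 1%:M by rewrite /U adj_row mul_row_col.
rewrite -(frob_unitary _ UU).
have -> : U^H *m (Cm - 1%:M) *m U = col_mx (row_mx E G) (row_mx G^H D).
  rewrite /U adj_row mul_col_mx mul_col_row !mulmxBr !mulmx1 !mulmxBl.
  by rewrite /block_mx ee ff ef fe !subr0 GH.
(* The four blocks contribute $1+3+3+9=16$ times $\eta$. *)
rewrite frob_col !frob_row frob_adj.
apply: (le_trans (lerD (lerD fE fG) (lerD fG fD))).
by rewrite le_eqVlt; apply/orP; left; apply/eqP; ring.
Qed.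

End UnitaryPotential.

(** * Spectra and the Riccati equation *)

Section Spectrum.
Variable C : numClosedFieldType.

Lemma normC_ge_Im (z : C) : `|'Im z| <= `|z|.
Proof.
rewrite -(@ler_pXn2r _ 2) ?nnegrE // [X in _ <= X]normC2_Re_Im real_normK ?Creal_Im //.
by rewrite lerDr real_exprn_even_ge0 ?Creal_Re.
Qed.

Lemma unitmx_eigenvalue n (A : 'M[C]_n) a : (A - a%:M \in unitmx) = ~~ eigenvalue A a.
Proof. by rewrite /eigenvalue /eigenspace kermx_eq0 negbK row_free_unit. Qed.

Lemma char_poly_roots n (A : 'M[C]_n) : {rs : seq C |
  [/\ size rs = n, char_poly A = \prod_(x <- rs) ('X - x%:P)
    & forall x, x \in rs -> eigenvalue A x]}.
Proof.
have [rs E] := closed_field_poly_normal (char_poly A).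
move: E; rewrite (monicP (char_poly_monic A)) scale1r => E.
exists rs; split => //.
  by have := size_char_poly A; rewrite E size_prod_XsubC => -[].
by move=> x xrs; rewrite eigenvalue_root_char E root_prod_XsubC.
Qed.

Lemma horner_char_poly n (A : 'M[C]_n) z : (char_poly A).[z] = \det (z%:M - A).
Proof.
rewrite /char_poly -/(horner_eval z _) -det_map_mx; congr (\det _).
by apply/matrixP => i j; rewrite !mxE /= /horner_eval !(hornerE, hornerMn).
Qed.

(** The determinant is the product of the $z-\lambda$, and
    $|z-\lambda|\ge\mathrm{Im}\,\lambda-\mathrm{Im}\,z\ge|\mathrm{Im}\,z|$. Unlike the spectral
    condition itself, this inequality passes directly to limits. *)
Lemma det_resolvent_ge n (A : 'M[C]_n) z :
  (forall a, eigenvalue A a -> 0 <= 'Im a) -> 'Im z < 0 ->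
  `|'Im z| ^+ n <= `|\det (z%:M - A)|.
Proof.
move=> specA z0; have [rs [szrs E spec]] := char_poly_roots A.
rewrite -horner_char_poly E -szrs horner_prod normr_prod.
elim: rs spec {szrs E} => [|x rs IHrs] spec; first by rewrite big_nil.
rewrite big_cons /= exprS ler_pM ?exprn_ge0 //.
  rewrite hornerXsubC; apply: le_trans (_ : `|'Im (z - x)| <= _); last first.
    by rewrite normC_ge_Im.
  have x0 := specA _ (spec x (mem_head _ _)).
  rewrite raddfB /= !ler0_norm ?subr_le0 ?(ltW z0) //; last first.
    by apply: le_trans x0; exact: ltW.
  by rewrite lerN2 gerBl.
by apply: IHrs => y yrs; apply: spec; rewrite inE yrs orbT.
Qed.

Lemma Im_trace_ge0 n (A : 'M[C]_n) :
  (forall a, eigenvalue A a -> 0 <= 'Im a) -> 0 <= 'Im (\tr A).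
Proof.
(* The trace is read off a coefficient of the characteristic polynomial, which requires positive
   dimension. *)
case: n A => [|n] A specA; first by rewrite /mxtrace big_ord0 raddf0.
have [rs [szrs E spec]] := char_poly_roots A.
have := char_poly_trace A isT; rewrite E -{1}szrs coefPn_prod_XsubC ?szrs //.
move/oppr_inj => <-; rewrite raddf_sum /= big_seq sumr_ge0 // => x xrs.
exact/specA/spec.
Qed.

(** Unitary diagonalization: the rows of $P$ are left eigenvectors, so every diagonal entry is at
    least $k$. *)
Lemma herm_eigenvalue_ge n (M : 'M[C]_n) (k : C) : k \is Num.real -> M^H = M ->
  (forall a, eigenvalue M a -> k <= a) -> psd (M - k%:M).
Proof.
move=> kR hM specM.
have normM : M \is normalmx.
  by apply/normalmxP; rewrite -!map_trmx -/(adj M) hM.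
have PU := spectral_unitarymx M; have uP := unitarymx_unit PU.
have PE : (spectralmx M)^H = invmx (spectralmx M) by rewrite invmx_unitary // /adj -map_trmx.
have /orthomx_spectralP := normM.
set P := spectralmx M in PU uP PE *; set sp := spectral_diag M => ME.
have spE i : k <= sp 0 i.
  apply: specM; apply/eigenvalueP; exists (row i P).
    rewrite {1}ME !mulmxA -row_mul mulmxV // -!row_mul mul1mx.
    apply/rowP => l; rewrite !mxE (bigD1 i) //= big1 ?addr0 => [|r /negPf ri].
      by rewrite !mxE eqxx mulr1n.
    by rewrite !mxE eq_sym ri mulr0n mul0r.
  apply: contraTneq uP => Pi0; rewrite unitmxE (expand_det_row _ i) big1 ?unitr0 // => l _.
  by have /rowP/(_ l) := Pi0; rewrite !mxE => ->; rewrite mul0r.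
have -> : M - k%:M = P^H *m (diag_mx sp - k%:M) *m P.
  by rewrite mulmxBr mulmxBl mul_mx_scalar -scalemxAl PE -ME mulVmx // scalemx1.
apply: psd_congr; split.
  apply/matrixP => i l; rewrite !mxE; have [->|] := eqVneq i l.
    by rewrite !mulr1n; apply/CrealP; rewrite realB // (ger_real (spE l)).
  by rewrite !mulr0n subr0 rmorph0.
move=> v; rewrite /qf mxE sumr_ge0 // => i _.
have -> : diag_mx sp - k%:M = diag_mx (sp - const_mx k).
  by apply/matrixP => r l; rewrite !mxE mulrnBl.
rewrite mul_mx_diag !mxE mulrAC mulr_ge0 ?subr_ge0 //.
by rewrite mulrC -normCK exprn_ge0.
Qed.

End Spectrum.

(** * Controllability and uniqueness of the Riccati solution *)

Section Riccati.
Variable C : numClosedFieldType.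

(** A Hautus-type form: the row space of [M] is an invariant space of left null vectors of [B]. Any
    number of rows is allowed, so that it applies to a single eigenvector as well as to a square
    limit matrix. *)
Definition controllable n m (A : 'M[C]_n) (B : 'M[C]_(n, m)) :=
  forall q (M : 'M[C]_(q, n)), M *m B = 0 -> (M *m A <= M)%MS -> M = 0.

(** The columns of [V] are a basis of the right kernel of [M], which contains the columns of [B], is
    invariant under [A], and has dimension $n-\mathrm{rank}\,M<n$. *)
Lemma uncontrollable_reduction n m q (A : 'M[C]_n) (B : 'M[C]_(n, m)) (M : 'M[C]_(q, n)) :
  M != 0 -> M *m B = 0 -> (M *m A <= M)%MS ->
  exists p, exists (V : 'M[C]_(n, p)) (A1 : 'M[C]_p) (B1 : 'M[C]_(p, m)),
    [/\ (p < n)%N, B = V *m B1 & A *m V = V *m A1].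
Proof.
move=> M0 MB /submxP[N MA]; pose K := kermx M^T.
have subK r (L : 'M[C]_(n, r)) : M *m L = 0 ->
    exists D, L = (row_base K)^T *m D.
  move=> ML; have /submxP[D LE] : (L^T <= row_base K)%MS.
    by rewrite eq_row_base; apply/sub_kermxP; rewrite -trmx_mul ML trmx0.
  by exists D^T; rewrite -trmx_mul -LE trmxK.
have MV : M *m (row_base K)^T = 0.
  apply: trmx_inj; rewrite trmx_mul trmxK trmx0; apply/sub_kermxP.
  by rewrite eq_row_base.
have [B1 BE] := subK _ _ MB.
have [|A1 AE] := subK _ (A *m (row_base K)^T).
  by rewrite mulmxA MA -mulmxA MV mulmx0.
exists (\rank K), (row_base K)^T, A1, B1; split=> //.
rewrite mxrank_ker mxrank_tr ltn_subrL lt0n mxrank_eq0 M0 /=.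
by apply: leq_trans (rank_leq_col M); rewrite lt0n mxrank_eq0.
Qed.

(** [V] intertwines the resolvents, since $(z-A)V=V(z-A_1)$. *)
Lemma transfer_reduction n p m1 m2 (A : 'M[C]_n) (B1 : 'M[C]_(p, m2)) (Cm : 'M[C]_(m1, n))
    (V : 'M[C]_(n, p)) (A1 : 'M[C]_p) z : A *m V = V *m A1 ->
  z%:M - A \in unitmx -> z%:M - A1 \in unitmx ->
  Cm *m V *m invmx (z%:M - A1) *m B1 = Cm *m invmx (z%:M - A) *m (V *m B1).
Proof.
move=> AV uA uA1; rewrite !mulmxA; congr (_ *m B1); rewrite -!mulmxA; congr (Cm *m _).
apply: (can_inj (mulKmx uA)); rewrite mulKVmx // mulmxA.
have -> : (z%:M - A) *m V = V *m (z%:M - A1).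
  by rewrite mulmxBl mulmxBr AV mul_scalar_mx mul_mx_scalar.
by rewrite -mulmxA mulmxV // mulmx1.
Qed.

Definition riccati n m1 m2 (A : 'M[C]_n) (B : 'M[C]_(n, m2)) (Cm : 'M[C]_(m1, n)) X :=
  X *m B *m B^H *m X - 'i *: (A^H *m X - X *m A) + Cm^H *m Cm.

(** In a row basis of [D], right multiplication by [A] acts as a square matrix [N]; an eigenvector
    of [N] exists because the field is algebraically closed. *)
Lemma stable_eigenvector n (D A : 'M[C]_n) : D != 0 -> (D *m A <= D)%MS ->
  exists lam (x : 'rV[C]_n), x *m D != 0 /\ x *m D *m A = lam *: (x *m D).
Proof.
move=> D0 DA; have /submxP[N NE] : (row_base D *m A <= row_base D)%MS.
  by rewrite eq_row_base (eqmxMr A (eq_row_base D)).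
have r0 : (0 < \rank D)%N by rewrite lt0n mxrank_eq0.
have [lam /eigenvalueP[u uN u0]] := eigenvalue_closed N r0.
have /submxP[x xE] : (u *m row_base D <= D)%MS.
  by rewrite mulmx_sub // eq_row_base.
exists lam, x; rewrite -xE; split.
  by rewrite mulmx_free_eq0 ?row_base_free.
by rewrite -mulmxA NE mulmxA uN scalemxAl.
Qed.

Lemma riccati_unique n m1 m2 (A : 'M[C]_n) (B : 'M[C]_(n, m2)) (Cm : 'M[C]_(m1, n)) X1 X2 :
  controllable A B -> X1^H = X1 -> X2^H = X2 ->
  riccati A B Cm X1 = 0 -> riccati A B Cm X2 = 0 ->
  (forall a, eigenvalue (A - 'i *: (B *m B^H *m X1)) a -> 0 <= 'Im a) ->
  (forall a, eigenvalue (A - 'i *: (B *m B^H *m X2)) a -> 0 <= 'Im a) ->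
  X1 = X2.
Proof.
move=> ctrl h1 h2 ric1 ric2 spec1 spec2.
set A1 := A - 'i *: (B *m B^H *m X1) in spec1; set A2 := A - 'i *: (B *m B^H *m X2) in spec2.
apply/eqP; rewrite -subr_eq0; apply/negPn/negP; set D := X1 - X2 => D0.
have hD : D^H = D by rewrite /D adjB h1 h2.
have ric12 : X1 *m B *m B^H *m X1 - X2 *m B *m B^H *m X2
    = 'i *: (A^H *m X1 - X1 *m A) - 'i *: (A^H *m X2 - X2 *m A).
  have := congr2 (fun M N => M - N) ric1 ric2; rewrite /riccati subr0 => /eqP.
  rewrite -(subr_eq0 (_ - _)) => h; apply/eqP; rewrite -subr_eq0; move: h.
  by congr (_ == 0); mx_abelian.
have A2H : A2^H = A^H + 'i *: (X2 *m B *m B^H).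
  by rewrite /A2 adjB adjZ !adjM adjK h2 conjCi scaleNr opprK !mulmxA.
have DA : D *m A1 = A2^H *m D.
  have ii : 'i * 'i = -1 :> C by rewrite -expr2 sqrCi.
  have -> : D *m A1 = X1 *m A - X2 *m A - 'i *: (X1 *m B *m B^H *m X1)
                      + 'i *: (X2 *m B *m B^H *m X1).
    by rewrite /A1 /D; mx_expand; mx_abelian.
  have -> : X1 *m B *m B^H *m X1 = X2 *m B *m B^H *m X2
      + ('i *: (A^H *m X1 - X1 *m A) - 'i *: (A^H *m X2 - X2 *m A)).
    by rewrite -ric12 addrC subrK.
  by rewrite A2H /D; mx_expand; rewrite ii; mx_abelian.
have DAD : D *m A1 - A1^H *m D = - 'i *: (D *m B *m B^H *m D).
  have -> : A1^H = A2^H + 'i *: (D *m B *m B^H).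
    by rewrite A2H /A1 adjB adjZ !adjM adjK h1 conjCi /D; mx_expand; mx_abelian.
  by rewrite [(_ + _) *m D]mulmxDl DA opprD addrA subrr add0r mulZmx scaleNr.
have [|lam [x [xD0 xDA]]] := stable_eigenvector (A := A1) D0.
  by rewrite DA submxMl.
have lam_ge0 : 0 <= 'Im lam by apply: spec1; apply/eigenvalueP; exists (x *m D).
have [lam_gt0|] := boolP (0 < 'Im lam).
  (* The spectrum of $A_2^*$ lies in the closed lower half-plane. *)
  have uE : A2^H - lam%:M \in unitmx.
    have -> : A2^H - lam%:M = (A2 - (lam^*)%:M)^H by rewrite adjB adj_scalar conjCK.
    rewrite unitmx_adj unitmx_eigenvalue; apply/negP => /spec2.
    by rewrite Im_conj oppr_ge0 => /(lt_le_trans lam_gt0); rewrite ltxx.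
  have kE : (kermx D *m (A2^H - lam%:M) <= kermx D)%MS.
    apply/sub_kermxP; rewrite -mulmxA mulmxBl -DA mul_scalar_mx mulmxBr mulmxA mulmx_ker.
    by rewrite mul0mx sub0r -scalemxAr mulmx_ker scaler0 oppr0.
  (* An injective map of the kernel into itself is onto, by equality of ranks; hence
     $x(A_2^*-\lambda)\in\ker D$ gives $x\in\ker D$. *)
  have Ek : (kermx D <= kermx D *m (A2^H - lam%:M))%MS.
    have := mxrank_leqif_sup kE; rewrite mxrankMfree ?row_free_unit // => -[_ <-].
    exact: eqxx.
  have xE : (x *m (A2^H - lam%:M) <= kermx D)%MS.
    apply/sub_kermxP; rewrite -mulmxA mulmxBl -DA mul_scalar_mx mulmxBr -scalemxAr.
    by rewrite mulmxA xDA subrr.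
  have := submx_trans xE Ek; rewrite submxMfree ?row_free_unit // => /sub_kermxP xD.
  by rewrite xD eqxx in xD0.
rewrite lt_def lam_ge0 andbT negbK => /eqP lam0.
have lamR : lam^* = lam by apply/CrealP/Creal_ImP.
pose w := x *m D.
(* Evaluate [DAD] at $x$: for real $\lambda$ the left side cancels, leaving $wBB^*w^*=0$. *)
have wB : w *m B = 0.
  apply/eqP; rewrite -frob_eq0 /frob adjM adjM hD.
  have := congr1 (fun M => x *m M *m x^H) DAD.
  rewrite mulmxBr mulmxBl [x *m (D *m A1)]mulmxA.
  have -> : x *m (A1^H *m D) *m x^H = (x *m D *m A1 *m x^H)^H.
    by rewrite !adjM adjK hD !mulmxA.
  rewrite xDA mulZmx adjZ [(x *m D *m x^H)^H]adjM adjM adjK hD lamR [x *m (D *m x^H)]mulmxA subrr.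
  move/esym/eqP; rewrite mulmxZ mulZmx scaler_eq0 oppr_eq0 (negPf (neq0Ci _)) /= => /eqP h.
  by rewrite /w; move: h; rewrite !mulmxA => ->; rewrite mxtrace0.
have wA : w *m A = lam *: w.
  have -> : A = A1 + 'i *: (B *m B^H *m X1) by rewrite /A1 subrK.
  by rewrite mulmxDr -scalemxAr !mulmxA wB !mul0mx scaler0 addr0.
have := ctrl _ w wB; rewrite wA scalemx_sub // => /(_ isT) w0.
by rewrite -/w w0 eqxx in xD0.
Qed.

End Riccati.

(** * Limits of matrices and of Riccati solutions *)

Section MatrixLimits.
Local Open Scope classical_set_scope.
Variables (C : numClosedFieldType) (T : Type) (F : set_system T).
Context {FF : ProperFilter F}.

Definition mcvg p q (f : T -> 'M[C]_(p, q)) (L : 'M[C]_(p, q)) :=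
  forall i j, (fun t => f t i j) @ F --> L i j.

(** The order is only partial, so closedness is obtained from $x\ge0\iff|x|=x$ and continuity of the
    norm. *)
Lemma cvg_ge0 (f : T -> C) l : (\forall t \near F, 0 <= f t) -> f @ F --> l -> 0 <= l.
Proof.
move=> f0 fl; suff <- : `|l| = l by [].
have nl : (fun t => `|f t|) @ F --> `|l| by apply: cvg_norm.
apply: (@cvg_unique _ _ (f @ F)) fl => //.
apply: cvg_trans nl; apply: near_eq_cvg.
by near=> t; rewrite ger0_norm //; near: t.
Unshelve. all: by end_near. Qed.

Lemma cvg_conj (f : T -> C) l : f @ F --> l -> (fun t => (f t)^*) @ F --> l^*.
Proof.
move=> fl; apply/cvgrPdist_lt => e e0; have /cvgrPdist_lt/(_ _ e0) := fl.
by apply: filterS => t; rewrite -rmorphB norm_conjC.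
Qed.

Lemma cvg_sumr (I : Type) (r : seq I) (P : pred I) (f : I -> T -> C) (l : I -> C) :
  (forall i, f i @ F --> l i) ->
  (fun t => \sum_(i <- r | P i) f i t) @ F --> \sum_(i <- r | P i) l i.
Proof.
move=> fl; elim: r => [|i r IHr].
  by rewrite big_nil; under eq_fun do rewrite big_nil; exact: cvg_cst.
rewrite big_cons; under eq_fun do rewrite big_cons.
by case: (P i) => //; apply: cvgD.
Qed.

Lemma cvg_prodr (I : Type) (r : seq I) (P : pred I) (f : I -> T -> C) (l : I -> C) :
  (forall i, f i @ F --> l i) ->
  (fun t => \prod_(i <- r | P i) f i t) @ F --> \prod_(i <- r | P i) l i.
Proof.
move=> fl; elim: r => [|i r IHr].
  by rewrite big_nil; under eq_fun do rewrite big_nil; exact: cvg_cst.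
rewrite big_cons; under eq_fun do rewrite big_cons.
by case: (P i) => //; apply: cvgM.
Qed.

Lemma mcvg_cst p q (L : 'M[C]_(p, q)) : mcvg (fun=> L) L.
Proof. by move=> i j; apply: cvg_cst. Qed.

Lemma mcvg_near_eq p q (f g : T -> 'M[C]_(p, q)) L :
  (\forall t \near F, f t = g t) -> mcvg f L -> mcvg g L.
Proof.
move=> fg fL i j; apply: cvg_trans (fL i j); apply: near_eq_cvg.
by near=> t; rewrite (_ : f t = g t) //; near: t.
Unshelve. all: by end_near. Qed.

Lemma mcvg_unique p q (f : T -> 'M[C]_(p, q)) L1 L2 : mcvg f L1 -> mcvg f L2 -> L1 = L2.
Proof. by move=> f1 f2; apply/matrixP => i j; apply: cvg_unique (f1 i j) (f2 i j). Qed.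

Lemma mcvgD p q (f g : T -> 'M[C]_(p, q)) L M :
  mcvg f L -> mcvg g M -> mcvg (fun t => f t + g t) (L + M).
Proof. by move=> fL gM i j; rewrite mxE; under eq_fun do rewrite mxE; apply: cvgD. Qed.

Lemma mcvgN p q (f : T -> 'M[C]_(p, q)) L : mcvg f L -> mcvg (fun t => - f t) (- L).
Proof. by move=> fL i j; rewrite mxE; under eq_fun do rewrite mxE; apply: cvgN. Qed.

Lemma mcvgB p q (f g : T -> 'M[C]_(p, q)) L M :
  mcvg f L -> mcvg g M -> mcvg (fun t => f t - g t) (L - M).
Proof. by move=> fL gM; apply: mcvgD => //; apply: mcvgN. Qed.

Lemma mcvgZ p q (a : T -> C) (b : C) (f : T -> 'M[C]_(p, q)) L :
  a @ F --> b -> mcvg f L -> mcvg (fun t => a t *: f t) (b *: L).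
Proof. by move=> ab fL i j; rewrite mxE; under eq_fun do rewrite mxE; apply: cvgM. Qed.

Lemma mcvgZl p q a (f : T -> 'M[C]_(p, q)) L : mcvg f L -> mcvg (fun t => a *: f t) (a *: L).
Proof. by apply: mcvgZ; apply: cvg_cst. Qed.

Lemma mcvgM p q r (f : T -> 'M[C]_(p, q)) (g : T -> 'M[C]_(q, r)) L M :
  mcvg f L -> mcvg g M -> mcvg (fun t => f t *m g t) (L *m M).
Proof.
move=> fL gM i j; rewrite mxE; under eq_fun do rewrite mxE.
by apply: cvg_sumr => k; apply: cvgM.
Qed.

Lemma mcvg_adj p q (f : T -> 'M[C]_(p, q)) L : mcvg f L -> mcvg (fun t => (f t)^H) L^H.
Proof. by move=> fL i j; rewrite !mxE; under eq_fun do rewrite !mxE; apply: cvg_conj. Qed.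

Lemma mcvg_tr p (f : T -> 'M[C]_p) L : mcvg f L -> (fun t => \tr (f t)) @ F --> \tr L.
Proof. by move=> fL; apply: cvg_sumr => i. Qed.

Lemma mcvg_det p (f : T -> 'M[C]_p) L : mcvg f L -> (fun t => \det (f t)) @ F --> \det L.
Proof.
move=> fL; apply: cvg_sumr => s; apply: cvgM; first exact: cvg_cst.
by apply: cvg_prodr => i.
Qed.

Lemma mcvg_unit p (f : T -> 'M[C]_p) L :
  mcvg f L -> L \in unitmx -> \forall t \near F, f t \in unitmx.
Proof.
move=> /mcvg_det fL; rewrite unitmxE unitfE => L0.
have fn0 : \forall t \near F, \det (f t) != 0 := cvgr_neq0 _ fL L0.
by near=> t; rewrite unitmxE unitfE; near: t; exact: fn0.
Unshelve. all: by end_near. Qed.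

(** Cramer's formula. It describes [invmx (f t)] only where [f t] is invertible, which holds near
    the limit. *)
Lemma mcvg_inv p (f : T -> 'M[C]_p) L :
  mcvg f L -> L \in unitmx -> mcvg (fun t => invmx (f t)) (invmx L).
Proof.
move=> fL uL; have uf := mcvg_unit fL uL.
have aL : mcvg (fun t => (\det (f t))^-1 *: \adj (f t)) ((\det L)^-1 *: \adj L).
  apply: mcvgZ; first by apply: cvgV; [rewrite -unitfE -unitmxE | apply: mcvg_det].
  move=> i j; rewrite mxE; under eq_fun do rewrite mxE.
  apply: cvgM; first exact: cvg_cst.
  by apply: mcvg_det => k l; rewrite !mxE; under eq_fun do rewrite !mxE; apply: fL.
move=> i j; rewrite {2}/invmx uL; apply: cvg_trans (aL i j).
apply: near_eq_cvg; near=> t; rewrite /invmx (_ : f t \in unitmx) //.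
by near: t.
Unshelve. all: by end_near. Qed.

Lemma psd_cvg p (f : T -> 'M[C]_p) L : (\forall t \near F, psd (f t)) -> mcvg f L -> psd L.
Proof.
move=> pf fL; split.
  apply: (mcvg_unique (mcvg_adj fL)) => i j; apply: cvg_trans (fL i j).
  by apply: near_eq_cvg; near=> t; have [-> _] : psd (f t) by near: t.
move=> v; apply: (@cvg_ge0 (fun t => qf (f t) v)).
  by near=> t; have [_ ->] : psd (f t) by near: t.
have h : mcvg (fun t => v^H *m f t *m v) (v^H *m L *m v).
  by apply: mcvgM; [apply: mcvgM => //|]; apply: mcvg_cst.
exact: h.
Unshelve. all: by end_near. Qed.

End MatrixLimits.

(** * Convergence of perturbed Riccati solutions along an ultrafilter *)

Section RiccatiLimit.
Local Open Scope classical_set_scope.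
Variables (C : numClosedFieldType) (T : Type) (F : set_system T).
Context {FU : UltraFilter F}.
Let FF : ProperFilter F := @ultra_proper _ _ FU.

(** Cauchy-Schwarz for the form $X$, applied to each column $b$ of $B$:
    $|b^*Xv|^2\le(b^*Xb)(v^*Xv)$; then sum over the columns. *)
Lemma psd_gram_dominated n m (X : 'M[C]_n) (B : 'M[C]_(n, m)) c :
  psd X -> \tr (B^H *m X *m B) <= c -> psd (c *: X - X *m B *m B^H *m X).
Proof.
move=> pX trc; have [hX X0] := pX.
have c0 : 0 <= c by apply: le_trans trc; apply/psd_tr/psd_congr.
split=> [|v].
  rewrite /herm adjB adjZ !adjM adjK hX !mulmxA; congr (_ *: _ - _).
  by apply/CrealP; rewrite ger0_real.
have -> : qf (c *: X - X *m B *m B^H *m X) v = c * qf X v - frob (B^H *m X *m v).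
  rewrite !qfE mulmxBr mulmxBl mxtraceB mulmxZ mulZmx mxtraceZ; congr (_ - _).
  by rewrite -frob_adj /frob adjK !adjM adjK hX !mulmxA.
rewrite subr_ge0; apply: le_trans (ler_wpM2r (X0 v) trc).
rewrite frobE mulr_suml ler_sum // => k _; rewrite big_ord1.
have := psd_cauchy_schwarz (col k B) v pX.
have -> : \tr ((col k B)^H *m X *m v) = (B^H *m X *m v) k 0.
  rewrite /mxtrace big_ord1 -!mulmxA.
  have -> : (col k B)^H = row k B^H by apply/rowP => l; rewrite !mxE.
  by rewrite -row_mul mxE.
have -> // : qf X (col k B) = (B^H *m X *m B) k k.
rewrite /qf; have -> : (col k B)^H = row k B^H by apply/rowP => l; rewrite !mxE.
by rewrite -row_mul colE mulmxA -row_mul -colE !mxE.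
Qed.

(** The form in which compactness enters; [complex_bounded_ultra_cvg] supplies it over [R[i]]. *)
Hypothesis bounded_cvg : forall (f : T -> C) (M : C),
  (\forall t \near F, `|f t| <= M) -> exists l : C, f @ F --> l.

Lemma psd_ultra_cvg n (X : T -> 'M[C]_n) (M : C) :
  (\forall t \near F, psd (X t) /\ \tr (X t) <= M) -> exists L, mcvg F X L.
Proof.
move=> Xb.
have e i j : exists l : C, (fun t => X t i j) @ F --> l.
  apply: (@bounded_cvg _ M); apply: filterS Xb => t [pX trX].
  apply: le_trans trX; have := le_trans (frob_entry (X t) i j) (psd_frob pX).
  by rewrite ler_pXn2r // nnegrE // psd_tr.
have [L LE] := choice (fun ij : 'I_n * 'I_n => e ij.1 ij.2).
exists (\matrix_(i, j) L (i, j)) => i j; rewrite mxE.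
exact: (LE (i, j)).
Qed.

Variables (n m1 m2 : nat).
Variables (A' : T -> 'M[C]_n) (B' : T -> 'M[C]_(n, m2)) (C' : T -> 'M[C]_(m1, n)).
Variables (X' : T -> 'M[C]_n) (A : 'M[C]_n) (B : 'M[C]_(n, m2)) (Cm : 'M[C]_(m1, n)).
Hypothesis toA : mcvg F A' A.
Hypothesis toB : mcvg F B' B.
Hypothesis toC : mcvg F C' Cm.
Hypothesis psdX' : forall t, psd (X' t).
Hypothesis ricX' : forall t, riccati (A' t) (B' t) (C' t) (X' t) = 0.
Hypothesis specX' : forall t a,
  eigenvalue (A' t - 'i *: (B' t *m (B' t)^H *m X' t)) a -> 0 <= 'Im a.
Hypothesis ctrlAB : controllable A B.

(** The trace of the closed-loop matrix has nonnegative imaginary part, and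
    $\mathrm{tr}(BB^*X)=\mathrm{tr}(B^*XB)$ is real. *)
Lemma tr_gain_le t : \tr ((B' t)^H *m X' t *m B' t) <= 'Im (\tr (A' t)).
Proof.
have := Im_trace_ge0 (specX' (t := t)).
rewrite mxtraceB mxtraceZ -mulmxA mxtrace_mulC.
have tr0 : 0 <= \tr ((B' t)^H *m X' t *m B' t) by apply/psd_tr/psd_congr.
rewrite raddfB /= ImMil; first by rewrite (Creal_ReP _ (ger0_real tr0)) subr_ge0.
Qed.

Lemma psd_le_kernel p q (Y Z : 'M[C]_p) (N : 'M[C]_(p, q)) c :
  psd Z -> psd (c *: Y - Z) -> Y *m N = 0 -> Z *m N = 0.
Proof.
move=> pZ [_ leYZ] YN; apply/matrixP => i j; rewrite mxE.
suff : Z *m col j N = 0.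
  by rewrite colE mulmxA -colE => /colP/(_ i); rewrite !mxE.
apply: psd_kernel => //; apply/eqP; rewrite eq_le (proj2 pZ) andbT.
have := leYZ (col j N); rewrite !qfE mulmxBr mulmxBl mxtraceB mulmxZ mulZmx mxtraceZ.
have -> : (col j N)^H *m Y *m col j N = 0.
  by rewrite -mulmxA (_ : Y *m col j N = 0) ?mulmx0 // colE mulmxA YN mul0mx.
by rewrite mxtrace0 mulr0 sub0r oppr_ge0.
Qed.

(** Otherwise the normalized solutions $X'/\mathrm{tr}\,X'$ converge to some $Y\ge0$ of trace 1. The
    Riccati equation at two different scales yields $YB=0$ and invariance of the row space of $Y$
    under $A$, so $Y=0$ by controllability. *)
Lemma riccati_bounded : exists M, \forall t \near F, \tr (X' t) <= M.
Proof.
apply: contrapT => /forallNP unbounded.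
(* An ultrafilter contains the complement of each set that it does not contain. *)
have big M : \forall t \near F, ~ \tr (X' t) <= M.
  by case: (in_ultra_setVsetC [set t | \tr (X' t) <= M] FU) => // /unbounded.
have trX0 t : 0 <= \tr (X' t) by apply: psd_tr.
pose ep t := (\tr (X' t))^-1.
have ep0 t : 0 <= ep t by rewrite invr_ge0.
have cvg_ep : ep @ F --> (0 : C).
  apply/cvgrPdist_lt => e e0; apply: filterS (big e^-1) => t tX.
  have ei0 : 0 < e^-1 by rewrite invr_gt0.
  have lt_e : e^-1 < \tr (X' t).
    by rewrite real_ltNge ?(ger0_real (trX0 t)) ?(ger0_real (ltW ei0)) //; apply/negP.
  have tX0 : 0 < \tr (X' t) := lt_trans ei0 lt_e.
  by rewrite sub0r normrN ger0_norm // -[e]invrK /ep ltf_pV2 // posrE invr_gt0.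
pose Y' t := ep t *: X' t.
have trY' : \forall t \near F, \tr (Y' t) = 1.
  apply: filterS (big 0) => t tX; rewrite /Y' mxtraceZ mulVf //.
  by apply: contra_notN tX => /eqP ->.
have pY' t : psd (Y' t) by apply: psdZ.
have [|Y cvgY] := @psd_ultra_cvg n Y' 1.
  by apply: filterS trY' => t ->.
have pY : psd Y by apply: psd_cvg cvgY; apply: nearW.
have [hY _] := pY.
have trY : \tr Y = 1.
  have c1 : (fun t => \tr (Y' t)) @ F --> (1 : C) by apply: cvg_near_cst.
  exact: cvg_unique (mcvg_tr cvgY) c1.
(* Multiplied by $(\mathrm{tr}\,X')^{-2}$, the Riccati equation keeps only its quadratic term in the
   limit. *)
have YBBY : Y *m B *m B^H *m Y = 0.
  have h : mcvg F (fun t => Y' t *m B' t *m (B' t)^H *m Y' t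
      - ep t *: ('i *: ((A' t)^H *m Y' t - Y' t *m A' t))
      + ep t *: (ep t *: ((C' t)^H *m C' t)))
    (Y *m B *m B^H *m Y - 0 *: ('i *: (A^H *m Y - Y *m A)) + 0 *: (0 *: (Cm^H *m Cm))).
    apply: mcvgD; first apply: mcvgB.
    - by apply: mcvgM => //; apply: mcvgM; [apply: mcvgM|apply: mcvg_adj].
    - apply: mcvgZ => //; apply: mcvgZl; apply: mcvgB; apply: mcvgM => //.
      exact: mcvg_adj.
    - apply: mcvgZ => //; apply: mcvgZ => //; apply: mcvgM => //; exact: mcvg_adj.
  move: h; rewrite !scale0r subr0 addr0 => h.
  suff h0 : mcvg F (fun=> 0) (Y *m B *m B^H *m Y).
    by apply: mcvg_unique h0 _; apply: mcvg_cst.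
  apply: mcvg_near_eq h; apply: nearW => t.
  have := congr1 (fun M => ep t *: (ep t *: M)) (ricX' t).
  rewrite /riccati !scaler0 => <-.
  by rewrite /Y'; mx_expand; mx_abelian.
have YB : Y *m B = 0.
  by apply/eqP; rewrite -frob_eq0 /frob adjM hY !mulmxA YBBY mxtrace0.
(* Eventually $|\mathrm{tr}\,A'-\mathrm{tr}\,A|<1$, so $c$ bounds $\mathrm{Im}\,\mathrm{tr}\,A'$ and
   hence $\mathrm{tr}(B'^*X'B')$. *)
pose c := `|\tr A| + 1.
pose Z' t := ep t *: (X' t *m B' t *m (B' t)^H *m X' t).
pose Z := 'i *: (A^H *m Y - Y *m A).
(* Multiplied once by $(\mathrm{tr}\,X')^{-1}$, the equation identifies the limit of the quadratic
   term with $\mathrm{i}(A^*Y-YA)$. *)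
have cvgZ : mcvg F Z' Z.
  have h : mcvg F (fun t => 'i *: ((A' t)^H *m Y' t - Y' t *m A' t)
      - ep t *: ((C' t)^H *m C' t)) ('i *: (A^H *m Y - Y *m A) - 0 *: (Cm^H *m Cm)).
    apply: mcvgB; last by apply: mcvgZ => //; apply: mcvgM => //; exact: mcvg_adj.
    by apply: mcvgZl; apply: mcvgB; apply: mcvgM => //; exact: mcvg_adj.
  move: h; rewrite scale0r subr0; apply: mcvg_near_eq; apply: nearW => t.
  apply/eqP; rewrite -subr_eq0; apply/eqP.
  have := congr1 (fun M => - ep t *: M) (ricX' t); rewrite /riccati scaler0 => <-.
  by rewrite /Y' /Z'; mx_expand; mx_abelian.
have pZ' t : psd (Z' t).
  apply: psdZ => //; have [hX _] := psdX' t.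
  have -> : X' t *m B' t *m (B' t)^H *m X' t = ((B' t)^H *m X' t)^H *m ((B' t)^H *m X' t).
    by rewrite adjM adjK hX !mulmxA.
  exact: psd_gram.
have pZ : psd Z by apply: psd_cvg cvgZ; apply: nearW.
have pcYZ : psd (c *: Y - Z).
  apply: psd_cvg (mcvgB (mcvgZl (a := c) cvgY) cvgZ).
  have trA0 : (fun t => \tr (A' t)) @ F --> (\tr A : C) by exact: mcvg_tr.
  have /cvgrPdist_lt/(_ 1 ltr01) := trA0; apply: filterS => t trA.
  have -> : c *: Y' t - Z' t = ep t *: (c *: X' t - X' t *m B' t *m (B' t)^H *m X' t).
    by rewrite scalerBr /Y' !scalerA mulrC.
  apply: psdZ => //; apply: psd_gram_dominated => //.
  apply: le_trans (tr_gain_le t) _.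
  apply: le_trans (real_ler_norm (Creal_Im _)) _; apply: le_trans (normC_ge_Im _) _.
  rewrite -[\tr (A' t)](subrK (\tr A)) addrC; apply: le_trans (ler_normD _ _) _.
  by rewrite lerD2l distrC ltW.
(* From $0\le Z\le cY$, a matrix [N] with $YN=0$ satisfies $0=ZN=-\mathrm{i}YAN$. *)
have YA : (Y *m A <= Y)%MS.
  have YN : Y *m cokermx Y = 0 by apply: mulmx_coker.
  have := psd_le_kernel pZ pcYZ YN; rewrite /Z mulZmx mulmxBl -(mulmxA _ Y) YN mulmx0 sub0r.
  move/eqP; rewrite scaler_eq0 (negPf (neq0Ci _)) oppr_eq0 /= => /eqP YAN.
  by rewrite submxE YAN.
have Y0 := ctrlAB YB YA.
by move: trY; rewrite Y0 mxtrace0 => /eqP; rewrite eq_sym oner_eq0.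
Qed.

Lemma riccati_cvg (X : 'M[C]_n) : X^H = X -> riccati A B Cm X = 0 ->
  (forall a, eigenvalue (A - 'i *: (B *m B^H *m X)) a -> 0 <= 'Im a) ->
  mcvg F X' X.
Proof.
move=> hX ricX specX; have [M XM] := riccati_bounded.
have [|L cvgX] := @psd_ultra_cvg n X' M; first by apply: filterS XM.
suff -> : X = L by [].
have [hL _] : psd L by apply: psd_cvg cvgX; apply: nearW.
have ricL : riccati A B Cm L = 0.
  have h : mcvg F (fun t => riccati (A' t) (B' t) (C' t) (X' t)) (riccati A B Cm L).
    apply: mcvgD; first apply: mcvgB.
    - by apply: mcvgM => //; apply: mcvgM; [apply: mcvgM|apply: mcvg_adj].
    - apply: mcvgZl; apply: mcvgB; apply: mcvgM => //; exact: mcvg_adj.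
    - apply: mcvgM => //; exact: mcvg_adj.
  suff h0 : mcvg F (fun=> 0) (riccati A B Cm L).
    by apply: mcvg_unique h0 _; apply: mcvg_cst.
  by apply: mcvg_near_eq h; apply: nearW => t.
apply: (riccati_unique ctrlAB hX hL ricX ricL specX) => a /eigenvalueP[v vA v0].
(* An eigenvalue $a$ below the real axis would make the limit determinant vanish, while the
   determinants along the filter are at least $|\mathrm{Im}\,a|^n$ in modulus. *)
rewrite real_leNgt ?Creal_Im ?real0 //; apply/negP => a0.
have cvgAL : mcvg F (fun t => a%:M - (A' t - 'i *: (B' t *m (B' t)^H *m X' t)))
    (a%:M - (A - 'i *: (B *m B^H *m L))).
  apply: mcvgB; first exact: mcvg_cst.
  by apply: mcvgB => //; apply: mcvgZl; apply: mcvgM => //; apply: mcvgM => //; apply: mcvg_adj.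
have det0 : \det (a%:M - (A - 'i *: (B *m B^H *m L))) = 0.
  by apply/eqP/det0P; exists v => //; rewrite mulmxBr vA mul_mx_scalar subrr.
set g := fun t => _ in cvgAL; set l := _ - _ in cvgAL det0.
have detl : (fun t => \det (g t)) @ F --> (\det l : C) by apply: mcvg_det.
have norml : (fun t => `|\det (g t)| : C) @ F --> (`|\det l| : C) by apply: cvg_norm.
have cst : (fun=> `|'Im a| ^+ n : C) @ F --> (`|'Im a| ^+ n : C) by apply: cvg_cst.
have : 0 <= `|\det l| - `|'Im a| ^+ n.
  have diff : (fun t => `|\det (g t)| - `|'Im a| ^+ n : C) @ F
      --> (`|\det l| - `|'Im a| ^+ n : C) by exact: cvgB norml cst.
  apply: cvg_ge0 diff; apply: nearW => t; rewrite subr_ge0.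
  by apply: det_resolvent_ge => // b; apply: specX'.
rewrite det0 normr0 sub0r oppr_ge0 => /(lt_le_trans _) h.
have : 0 < `|'Im a| ^+ n by rewrite exprn_gt0 // normr_gt0 lt_eqF.
by move/h; rewrite ltxx.
Qed.

End RiccatiLimit.

(** * The recursive sequences *)

Lemma unitmx_exp (F : comUnitRingType) n (M : 'M[F]_n) k : M \in unitmx -> M ^+ k \in unitmx.
Proof.
move=> uM; elim: k => [|k IHk]; first by rewrite expr0 unitmx1.
by rewrite exprS -[M * _]/(M *m _) unitmx_mul uM.
Qed.

Section Sequences.
Variable C : numClosedFieldType.
Variables (n m : nat) (T : 'M[C]_n) (j : 'M[C]_m).

Fixpoint piseq (P0 : 'M[C]_(n, m)) k :=
  if k is k.+1 then piseq P0 k + 'i *: (T *m piseq P0 k *m j) else P0.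

Fixpoint sseq P0 (S0 : 'M[C]_n) k :=
  if k is k.+1 then
    sseq P0 S0 k + T *m sseq P0 S0 k *m T^H + T *m piseq P0 k *m (piseq P0 k)^H *m T^H
  else S0.

Definition potential P0 S0 k :=
  step_potential (sseq P0 S0 k) (sseq P0 S0 k.+1) (piseq P0 k) (piseq P0 k.+1).

Definition wmx (s : C) : 'M[C]_n := 1%:M + (s * 'i) *: T.

(* For s = 1 and s = -1 these are the sequences R_k and Q_k. *)
Definition hseq s P0 S0 k :=
  invmx (wmx s ^+ k) *m sseq P0 S0 k *m (invmx (wmx s ^+ k))^H.

Definition gain p (e : 'M[C]_(m, p)) P0 S0 k :=
  (piseq P0 k *m e)^H *m invmx (sseq P0 S0 k) *m (piseq P0 k *m e).

Lemma sseq_pd P0 S0 k : pd S0 -> pd (sseq P0 S0 k).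
Proof. by move=> pS0; elim: k => [|k IHk] //; apply: step_pd IHk. Qed.

Lemma piseq_block p (e : 'M[C]_(m, p)) s P0 k : j *m e = s *: e ->
  piseq P0 k *m e = wmx s ^+ k *m (P0 *m e).
Proof.
move=> je; elim: k => [|k IHk]; first by rewrite expr0 mul1mx.
rewrite exprS -[wmx s * _]/(wmx s *m _) -mulmxA -IHk /= mulmxDl mulZmx -(mulmxA _ j e) je.
by rewrite /wmx mulmxDl mul1mx !mulZmx mulmxZ scalerA mulrC mulmxA.
Qed.

Lemma hseq_psd s P0 S0 k (kap : C) : pd S0 -> kap \is Num.real ->
  (forall a, eigenvalue (hseq s P0 S0 k) a -> kap <= a) ->
  psd (hseq s P0 S0 k - kap%:M).
Proof.
move=> pS0 kapR; apply: herm_eigenvalue_ge => //.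
by have [hS _] := sseq_pd P0 k pS0; rewrite /hseq !adjM adjK hS mulmxA.
Qed.

(* invmx M = M when M is singular, so a left null vector of T = invmx A = A is fixed by all
   the factors of R_k and Q_k, whose quadratic form at it is thus constant. *)
Lemma hseq_unbounded_unit s P0 S0 : pd S0 ->
  (forall kap : C, 0 < kap -> exists k, forall a, eigenvalue (hseq s P0 S0 k) a -> kap <= a) ->
  forall A, T = invmx A -> A \in unitmx.
Proof.
move=> pS0 unb A TE; apply/negPn/negP => nuA.
have TA : T = A by rewrite TE /invmx (negPf nuA).
have /rowV0Pn[v /sub_kermxP vA v0] : kermx A != 0 by rewrite kermx_eq0 row_free_unit.
have vT : v *m T = 0 by rewrite TA.
have vS k : v *m sseq P0 S0 k *m v^H = v *m S0 *m v^H.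
  elim: k => //= k <-; rewrite !mulmxDr !mulmxDl !mulmxA vT !mul0mx !addr0.
  by [].
have vW k : v *m wmx s ^+ k = v.
  elim: k => [|k IHk]; first by rewrite expr0 mulmx1.
  rewrite exprS -[wmx s * _]/(wmx s *m _) mulmxA mulmxDr mulmx1 mulmxZ vT scaler0 addr0.
  exact: IHk.
have vWi k : v *m invmx (wmx s ^+ k) = v.
  have [u|nu] := boolP (wmx s ^+ k \in unitmx); first by rewrite -{1}(vW k) mulmxK.
  by rewrite /invmx (negPf nu) vW.
have frob0 : 0 < frob v.
  by rewrite lt_def frob_ge0 frob_eq0 v0.
pose b := \tr (v *m S0 *m v^H).
have b0 : 0 <= b by rewrite /b -{1}[v]adjK; apply/psd_tr/psd_congr/pd_psd.
(* The form of the sequence at $v^*$ is constantly $b$, whereas the lower bound [kap] would make it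
   at least $b+1$. *)
pose kap := (b + 1) / frob v.
have kap0 : 0 < kap by rewrite divr_gt0 // ltr_wpDl.
have [k specH] := unb _ kap0.
have [_ /(_ v^H)] := hseq_psd pS0 (gtr0_real kap0) specH.
rewrite qfE adjK mulmxBr mulmxBl mxtraceB mul_mx_scalar mulZmx mxtraceZ -/(frob v).
rewrite divfK ?gt_eqF // /hseq !mulmxA vWi -(mulmxA _ _ v^H) -adjM vWi vS -/b.
by rewrite opprD addrA subrr add0r oppr_ge0 ler10.
Qed.

(* theta^* H^-1 theta <= kap^-1 theta^* theta when H >= kap. *)
Lemma gain_small p (e : 'M[C]_(m, p)) s P0 S0 (eta : C) : pd S0 -> j *m e = s *: e ->
  wmx s \in unitmx -> 0 < eta ->
  (forall kap : C, 0 < kap -> exists k, forall a, eigenvalue (hseq s P0 S0 k) a -> kap <= a) ->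
  exists k, \tr (gain e P0 S0 k) < eta.
Proof.
move=> pS0 je uW eta0 unb; pose th := P0 *m e.
have b0 : 0 <= frob th := frob_ge0 th.
(* Chosen so that $\kappa\,\mathrm{tr}\,g_k\le\|\theta\|^2<\kappa\eta$. *)
pose kap := (frob th + 1) / eta.
have kap0 : 0 < kap by rewrite divr_gt0 // ltr_wpDl.
have [k specH] := unb _ kap0; exists k.
have pH := hseq_psd pS0 (gtr0_real kap0) specH.
have uWk : wmx s ^+ k \in unitmx by apply: unitmx_exp.
have uS := pd_unit (sseq_pd P0 k pS0).
have pkap : psd (kap%:M : 'M[C]_n).
  by rewrite -scalemx1; apply: psdZ (psd1 _ _); apply: ltW.
have pdH : pd (hseq s P0 S0 k).
  have -> : hseq s P0 S0 k = kap%:M + (hseq s P0 S0 k - kap%:M) by rewrite addrC subrK.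
  apply: pdD => //; split=> [|v v0]; first by case: pkap.
  rewrite qfE mul_mx_scalar mulZmx mxtraceZ mulr_gt0 // -[v in _ *m v]adjK -/(frob _).
  by rewrite frob_adj lt_def frob_ge0 frob_eq0 v0.
(* This reads $\kappa\,\theta^*\theta-\kappa^2\theta^*H^{-1}\theta\ge0$, where
   $\theta^*H^{-1}\theta=g_k$ because the powers of [wmx s] cancel. *)
have := psd_square (W := 1%:M) th pkap pdH.
rewrite adj1 mulmx1 mul1mx mul_scalar_mx mul_mx_scalar mulZmx => /(_ pH)/psd_tr.
have -> : (kap *: th)^H *m invmx (hseq s P0 S0 k) *m (kap *: th)
    = (kap * kap) *: gain e P0 S0 k.
  have -> : invmx (hseq s P0 S0 k)
      = (wmx s ^+ k)^H *m invmx (sseq P0 S0 k) *m wmx s ^+ k.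
    apply: (can_inj (mulKmx (pd_unit pdH))); rewrite mulmxV ?pd_unit // /hseq adj_inv.
    by rewrite !mulmxA mulmxKV ?unitmx_adj // mulmxK // mulVmx.
  rewrite adjZ (CrealP (gtr0_real kap0)) mulmxZ !mulZmx scalerA; congr (_ *: _).
  by rewrite /gain (piseq_block _ _ je) -/th adjM !mulmxA.
rewrite mxtraceB !mxtraceZ mxtrace_mulC -/(frob th) subr_ge0 -mulrA ler_pM2l // => le_th.
rewrite -(ltr_pM2l kap0); apply: le_lt_trans le_th _.
by rewrite divfK ?gt_eqF // ltrDl.
Qed.

Variables (A S0 : 'M[C]_n) (P0 : 'M[C]_(n, m)).
Hypothesis TA : T *m A = 1%:M.
Hypothesis hj : j^H = j.
Hypothesis jj : j *m j = 1%:M.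
Hypothesis pS0 : pd S0.
Hypothesis disp0 : A *m S0 - S0 *m A^H = 'i *: (P0 *m j *m P0^H).

Lemma sseq_displacement k :
  A *m sseq P0 S0 k - sseq P0 S0 k *m A^H = 'i *: (piseq P0 k *m j *m (piseq P0 k)^H).
Proof. by elim: k => [|k IHk] //; exact: step_displacement TA (erefl _) (erefl _) IHk hj jj. Qed.

(** Completing the square at $q=S_k^{-1}P_ke$ with $W=1+s\mathrm{i}T$: then $WS_kq=P_{k+1}e$, and
    [step_order] provides $WS_kW^*\le S_{k+1}$. *)
Lemma gain_step p (e : 'M[C]_(m, p)) s k : s^* = s -> s * s = 1 -> j *m e = s *: e ->
  psd (gain e P0 S0 k - gain e P0 S0 k.+1).
Proof.
move=> sR ss je; have pS := sseq_pd P0 k pS0; have pS' := sseq_pd P0 k.+1 pS0.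
have uS := pd_unit pS; have [hS _] := pS.
have ord := step_order TA (erefl _) (sseq_displacement k) hj jj sR ss.
set Pe := piseq P0 k *m e; set S := sseq P0 S0 k in pS uS hS ord *.
have P'e : piseq P0 k.+1 *m e = wmx s *m Pe.
  by rewrite /Pe !(piseq_block _ _ je) [RHS]mulmxA exprS.
have := psd_square (invmx S *m Pe) (pd_psd pS) pS' ord.
have -> : (invmx S *m Pe)^H *m S *m (invmx S *m Pe) = gain e P0 S0 k.
  by rewrite adjM adj_inv hS mulmxKV // mulmxA.
by rewrite -(mulmxA _ S) mulKVmx // -/(wmx s) -P'e.
Qed.

Lemma gain_potential p (e : 'M[C]_(m, p)) k : e^H *m e = 1%:M ->
  e^H *m potential P0 S0 k *m e - 1%:M = gain e P0 S0 k - gain e P0 S0 k.+1.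
Proof.
move=> ee; rewrite /potential /step_potential /gain !mulmxBr !mulmxBl mulmxDr mulmxDl mulmx1 ee.
by rewrite !adjM !mulmxA addrAC [1%:M + _]addrC addrK.
Qed.

(** The selected diagonal block exceeds the identity by $g_k-g_{k+1}$, of trace at most
    $\mathrm{tr}\,g_k\le\mathrm{tr}\,g_N\le\eta$; [unitary_potential_close] extends this to the
    whole matrix. *)
Lemma potential_tail p q (e : 'M[C]_(m, p)) (f : 'M[C]_(m, q)) s N k (eta : C) :
  s^* = s -> s * s = 1 -> e^H *m e = 1%:M -> f^H *m f = 1%:M ->
  e *m e^H + f *m f^H = 1%:M -> j = s *: (e *m e^H - f *m f^H) -> j *m e = s *: e ->
  \tr (gain e P0 S0 N) <= eta -> eta <= 1 -> (N <= k)%N ->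
  frob (potential P0 S0 k - 1%:M) <= 16%:R * eta.
Proof.
move=> sR ss ee ff eeff jE je trN eta1 Nk.
have pS := sseq_pd P0 k pS0.
have step l : psd (gain e P0 S0 l - gain e P0 S0 l.+1) by exact: gain_step sR ss je.
have gain0 l : 0 <= \tr (gain e P0 S0 l).
  by apply/psd_tr/psd_congr/pd_psd/pd_inv/sseq_pd.
have trk : \tr (gain e P0 S0 k) <= \tr (gain e P0 S0 N).
  rewrite -(subnK Nk); elim: (k - N)%N => //= l IHl; rewrite addSn.
  by apply: le_trans _ IHl; rewrite -subr_ge0 -mxtraceB; apply: psd_tr.
have s0 : s != 0 by apply: contra_eq_neq ss => ->; rewrite mul0r eq_sym oner_eq0.
apply: (unitary_potential_close (e := e) (f := f)) => //.
- exact: step_potential_psd (erefl _) (erefl _) hj jj pS.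
- apply: (scalerI s0); rewrite -mulZmx -mulmxZ -jE.
  exact: step_potential_unitary TA (erefl _) (erefl _) (sseq_displacement k) hj jj pS.
- by rewrite gain_potential.
- rewrite gain_potential // mxtraceB; apply: le_trans _ trN; apply: le_trans _ trk.
  by rewrite gerBl.
Qed.

End Sequences.

(** * Stability along a filter *)

Section Recovery.
Variable C : numClosedFieldType.

Definition signature m1 m2 : 'M[C]_(m1 + m2) := block_mx 1%:M 0 0 (- 1%:M).

Definition closed_loop n m (A : 'M[C]_n) (B : 'M[C]_(n, m)) X := A - 'i *: (B *m B^H *m X).

Definition initial_pi n m1 m2 (B : 'M[C]_(n, m2)) (Cm : 'M[C]_(m1, n)) X :=
  row_mx ('i *: (invmx X *m Cm^H)) B.

Definition recovered n m1 m2 (A : 'M[C]_n) (B : 'M[C]_(n, m2)) (Cm : 'M[C]_(m1, n)) X k :=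
  potential (invmx (closed_loop A B X)) (signature m1 m2) (initial_pi B Cm X) (invmx X) k.

Lemma signature_adj m1 m2 : (signature m1 m2)^H = signature m1 m2.
Proof. by rewrite /signature adj_block adjN !adj0 !adj1. Qed.

Lemma signature_sqr m1 m2 : signature m1 m2 *m signature m1 m2 = 1%:M.
Proof.
rewrite /signature mulmx_block !mulmx0 !mul0mx !addr0 !add0r mulNmx mulmxN !mulmx1 opprK.
by rewrite -scalar_mx_block.
Qed.

(** The Riccati equation multiplied by $X^{-1}$ on both sides. It is the base case of the
    displacement identity along the recursion. *)
Lemma riccati_displacement n m1 m2 (A : 'M[C]_n) (B : 'M[C]_(n, m2)) (Cm : 'M[C]_(m1, n)) X :
  pd X -> riccati A B Cm X = 0 ->
  closed_loop A B X *m invmx X - invmx X *m (closed_loop A B X)^H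
  = 'i *: (initial_pi B Cm X *m signature m1 m2 *m (initial_pi B Cm X)^H).
Proof.
move=> pX ricX; have uX := pd_unit pX; have [hX _] := pX.
have -> : initial_pi B Cm X *m signature m1 m2 *m (initial_pi B Cm X)^H
    = invmx X *m Cm^H *m Cm *m invmx X - B *m B^H.
  rewrite /initial_pi /signature mul_row_block adj_row mul_row_col !mulmx0 addr0 add0r !mulmx1.
  rewrite adjZ adjM adjK adj_inv hX conjCi mulmxN mulmx1 mulNmx mulZmx mulmxZ scalerA.
  by rewrite mulrN -expr2 sqrCi opprK scale1r !mulmxA.
have := congr1 (fun M => 'i *: (invmx X *m M *m invmx X)) ricX.
rewrite /riccati mulmx0 mul0mx scaler0; mx_expand.
rewrite mulVmx // !mul1mx -!(mulmxA _ X (invmx X)) mulmxV // !mulmx1.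
have ii : 'i * 'i = -1 :> C by rewrite -expr2 sqrCi.
rewrite ii => ric.
rewrite /closed_loop adjB adjZ !adjM adjK hX conjCi.
mx_expand; rewrite mulVmx // mul1mx.
apply/eqP; rewrite -subr_eq0; apply/eqP; rewrite -[RHS]oppr0 -ric; mx_abelian.
Qed.

(** $1+s\mathrm{i}A^{-1}=A^{-1}(A+s\mathrm{i})$. *)
Lemma wmx_unit n (A : 'M[C]_n) s : A \in unitmx -> ~~ eigenvalue A (- (s * 'i)) ->
  wmx (invmx A) s \in unitmx.
Proof.
move=> uA; rewrite -unitmx_eigenvalue raddfN /= opprK => uAs.
have -> : wmx (invmx A) s = invmx A *m (A + (s * 'i)%:M).
  by rewrite mulmxDr mulVmx // mul_mx_scalar.
by rewrite unitmx_mul unitmx_inv uA.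
Qed.

End Recovery.

Section Stability.
Local Open Scope classical_set_scope.
Variables (C : numClosedFieldType) (T : Type) (F : set_system T).
Context {FF : ProperFilter F}.

Lemma mcvg_near p q (f : T -> 'M[C]_(p, q)) L (eps : C) : mcvg F f L -> 0 < eps ->
  \forall t \near F, forall i l, `|(L - f t) i l| < eps.
Proof.
move=> fL eps0; apply: filter_forall => i; apply: filter_forall => l.
have /cvgrPdist_lt/(_ _ eps0) := fL i l; apply: filterS => t.
by rewrite !mxE.
Qed.

Lemma dist_entry_lt p q (M N L : 'M[C]_(p, q)) i l (eps : C) :
  `|(M - L) i l| < eps / 2 -> `|(N - L) i l| < eps / 2 -> `|(M - N) i l| < eps.
Proof.
rewrite !mxE => Ml Nl.
have -> : M i l - N i l = (M i l - L i l) - (N i l - L i l) by rewrite opprB addrA subrK.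
by rewrite [X in _ < X](splitr eps); apply: le_lt_trans (ler_normB _ _) (ltrD Ml Nl).
Qed.

Section SequenceLimits.
Variables (n m : nat) (j : 'M[C]_m).
Variables (Q' : T -> 'M[C]_n) (P' : T -> 'M[C]_(n, m)) (S' : T -> 'M[C]_n).
Variables (Q : 'M[C]_n) (P : 'M[C]_(n, m)) (S : 'M[C]_n).
Hypothesis toQ : mcvg F Q' Q.
Hypothesis toP : mcvg F P' P.
Hypothesis toS : mcvg F S' S.
Hypothesis pS : pd S.

Lemma mcvg_piseq k : mcvg F (fun t => piseq (Q' t) j (P' t) k) (piseq Q j P k).
Proof.
elim: k => [|k IHk] //=; apply: mcvgD => //; apply: mcvgZl; apply: mcvgM; last exact: mcvg_cst.
exact: mcvgM.
Qed.

Lemma mcvg_sseq k : mcvg F (fun t => sseq (Q' t) j (P' t) (S' t) k) (sseq Q j P S k).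
Proof.
have toQH : mcvg F (fun t => (Q' t)^H) Q^H by exact: mcvg_adj.
elim: k => [|k IHk] //=.
have toPk : mcvg F (fun t => piseq (Q' t) j (P' t) k) (piseq Q j P k) by exact: mcvg_piseq.
have toPkH : mcvg F (fun t => (piseq (Q' t) j (P' t) k)^H) (piseq Q j P k)^H.
  exact: mcvg_adj.
apply: mcvgD; [apply: mcvgD; first exact: IHk|].
  by apply: mcvgM; [apply: mcvgM; [exact: toQ | exact: IHk] | exact: toQH].
apply: mcvgM; last exact: toQH.
by apply: mcvgM; [apply: mcvgM; [exact: toQ | exact: toPk] | exact: toPkH].
Qed.

Lemma mcvg_sseq_inv k :
  mcvg F (fun t => invmx (sseq (Q' t) j (P' t) (S' t) k)) (invmx (sseq Q j P S k)).
Proof. by apply: mcvg_inv; [exact: mcvg_sseq | apply/pd_unit/sseq_pd]. Qed.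

Lemma mcvg_gain p (e : 'M[C]_(m, p)) k :
  mcvg F (fun t => gain (Q' t) j e (P' t) (S' t) k) (gain Q j e P S k).
Proof.
have toPe : mcvg F (fun t => piseq (Q' t) j (P' t) k *m e) (piseq Q j P k *m e).
  by apply: mcvgM; [exact: mcvg_piseq | exact: mcvg_cst].
by apply: mcvgM => //; apply: mcvgM; [apply: mcvg_adj | apply: mcvg_sseq_inv].
Qed.

Lemma mcvg_potential k :
  mcvg F (fun t => potential (Q' t) j (P' t) (S' t) k) (potential Q j P S k).
Proof.
have term l : mcvg F (fun t => (piseq (Q' t) j (P' t) l)^H
      *m invmx (sseq (Q' t) j (P' t) (S' t) l) *m piseq (Q' t) j (P' t) l)
    ((piseq Q j P l)^H *m invmx (sseq Q j P S l) *m piseq Q j P l).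
  apply: mcvgM; last exact: mcvg_piseq.
  apply: mcvgM; last exact: mcvg_sseq_inv.
  by apply: mcvg_adj; exact: mcvg_piseq.
by apply: mcvgB; [apply: mcvgD; [exact: mcvg_cst | exact: term] | exact: term].
Qed.

End SequenceLimits.

Variables (n m1 m2 : nat).
Variables (A' : T -> 'M[C]_n) (B' : T -> 'M[C]_(n, m2)) (C' : T -> 'M[C]_(m1, n)).
Variables (X' : T -> 'M[C]_n) (A : 'M[C]_n) (B : 'M[C]_(n, m2)) (Cm : 'M[C]_(m1, n)).
Variable X : 'M[C]_n.
Hypothesis toA : mcvg F A' A.
Hypothesis toB : mcvg F B' B.
Hypothesis toC : mcvg F C' Cm.
Hypothesis toX : mcvg F X' X.
Hypothesis pX : pd X.
Hypothesis pX' : forall t, pd (X' t).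
Hypothesis ricX : riccati A B Cm X = 0.
Hypothesis ricX' : forall t, riccati (A' t) (B' t) (C' t) (X' t) = 0.

Local Notation j := (signature C m1 m2).
Local Notation gain_at e := (gain (invmx (closed_loop A B X)) j e (initial_pi B Cm X) (invmx X)).

(** Below $N$, finitely many potentials converge. From $N$ on, the original and the perturbed
    potentials both lie within $\varepsilon/2$ of the identity, entry by entry. *)
Lemma recovered_stable p q (e : 'M[C]_(m1 + m2, p)) (f : 'M[C]_(m1 + m2, q)) s (eps : C) :
  closed_loop A B X \in unitmx -> s^* = s -> s * s = 1 -> e^H *m e = 1%:M -> f^H *m f = 1%:M ->
  e *m e^H + f *m f^H = 1%:M -> j = s *: (e *m e^H - f *m f^H) -> j *m e = s *: e ->
  (forall eta : C, 0 < eta -> exists N, \tr (gain_at e N) < eta) ->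
  0 < eps -> eps <= 1 ->
  \forall t \near F, forall k i l,
    `|(recovered A B Cm X k - recovered (A' t) (B' t) (C' t) (X' t) k) i l| < eps.
Proof.
move=> uA sR ss ee ff eeff jE je small eps0 eps1.
(* Any denominator above 64 gives $16\eta<(\varepsilon/2)^2$. *)
pose eta := eps ^+ 2 / 68%:R.
have eta0 : 0 < eta by rewrite divr_gt0 ?exprn_gt0 ?ltr0n.
have eta1 : eta <= 1.
  rewrite ler_pdivrMr ?ltr0n // mul1r; apply: (@le_trans _ _ 1); last by rewrite ler1n.
  by rewrite expr_le1 // ltW.
have [N gainN] := small _ eta0.
have toCl : mcvg F (fun t => closed_loop (A' t) (B' t) (X' t)) (closed_loop A B X).
  apply: mcvgB => //; apply: mcvgZl; apply: mcvgM => //; apply: mcvgM => //; exact: mcvg_adj.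
have toQ : mcvg F (fun t => invmx (closed_loop (A' t) (B' t) (X' t))) (invmx (closed_loop A B X)).
  exact: mcvg_inv.
have toS : mcvg F (fun t => invmx (X' t)) (invmx X) by apply: mcvg_inv (pd_unit pX).
have toP : mcvg F (fun t => initial_pi (B' t) (C' t) (X' t)) (initial_pi B Cm X).
  have toL : mcvg F (fun t => 'i *: (invmx (X' t) *m (C' t)^H)) ('i *: (invmx X *m Cm^H)).
    by apply: mcvgZl; apply: mcvgM => //; exact: mcvg_adj.
  move=> a b; rewrite /initial_pi mxE; under eq_fun do rewrite mxE.
  by case: (split b) => c; [apply: toL | apply: toB].
have pS := pd_inv pX.
have close Y (AY : 'M[C]_n) BY CY k : pd Y -> riccati AY BY CY Y = 0 ->
    closed_loop AY BY Y \in unitmx ->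
    \tr (gain (invmx (closed_loop AY BY Y)) j e (initial_pi BY CY Y) (invmx Y) N) <= eta ->
    (N <= k)%N -> forall i l, `|(recovered AY BY CY Y k - 1%:M) i l| < eps / 2.
  move=> pY ricY uY trN Nk i l.
  have := potential_tail (mulVmx uY) (signature_adj _ _ _) (signature_sqr _ _ _) (pd_inv pY)
    (riccati_displacement pY ricY) sR ss ee ff eeff jE je trN eta1 Nk.
  move/(le_trans (frob_entry _ i l)) => h.
  have e20 : 0 <= eps / 2 by rewrite divr_ge0 // ltW.
  rewrite -(@ltr_pXn2r _ 2) // ?nnegrE //; apply: le_lt_trans h _.
  rewrite /eta exprMn exprVn mulrCA ltr_pM2l ?exprn_gt0 //.
  rewrite -natrX ltr_pdivrMr ?ltr0n // mulrC ltr_pdivlMr ?ltr0n //.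
  by rewrite -natrM ltr_nat.
(* The strict inequality $\mathrm{tr}\,g_N<\eta$ is kept by nearby data, since $g_N$ depends
   continuously on them. *)
have near_tail : \forall t \near F,
    \tr (gain (invmx (closed_loop (A' t) (B' t) (X' t))) j e
          (initial_pi (B' t) (C' t) (X' t)) (invmx (X' t)) N) <= eta.
  have trg : (fun t => \tr (gain (invmx (closed_loop (A' t) (B' t) (X' t))) j e
          (initial_pi (B' t) (C' t) (X' t)) (invmx (X' t)) N)) @ F --> (\tr (gain_at e N) : C).
    by apply: mcvg_tr; apply: mcvg_gain.
  have d0 : 0 < eta - \tr (gain_at e N) by rewrite subr_gt0.
  have /cvgrPdist_lt/(_ _ d0) := trg; apply: filterS => t; rewrite distrC => /ltW h.
  rewrite -[X in X <= _](subrK (\tr (gain_at e N))) -lerBrDr; apply: le_trans h.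
  apply: real_ler_norm; rewrite realB // ger0_real //; apply/psd_tr/psd_congr/pd_psd/pd_inv/sseq_pd => //.
  exact: pd_inv.
have near_unit : \forall t \near F, closed_loop (A' t) (B' t) (X' t) \in unitmx.
  exact: mcvg_unit toCl uA.
have near_head : forall M, \forall t \near F, forall k, (k < M)%N -> forall i l,
    `|(recovered A B Cm X k - recovered (A' t) (B' t) (C' t) (X' t) k) i l| < eps.
  elim=> [|M IHM]; first by apply: nearW.
  have toM : mcvg F (fun t => recovered (A' t) (B' t) (C' t) (X' t) M) (recovered A B Cm X M).
    exact: mcvg_potential.
  have all_entries := mcvg_near toM eps0.
  apply: filterS2 IHM all_entries => t lt_M eq_M k; rewrite ltnS leq_eqVlt => /orP[/eqP->|/lt_M] //.
apply: filterS3 near_unit near_tail (near_head N) => t ut trt headt k i l.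
have [kN|Nk] := ltnP k N; first exact: headt.
apply: dist_entry_lt (close X A B Cm k pX ricX uA (ltW gainN) Nk i l) _.
exact: close (pX' t) (ricX' t) ut trt Nk i l.
Qed.

Lemma recovered_stable_unbounded s (eps : C) : s = 1 \/ s = -1 ->
  ~~ eigenvalue (closed_loop A B X) (- (s * 'i)) ->
  (forall kap : C, 0 < kap -> exists k, forall a,
    eigenvalue (hseq (invmx (closed_loop A B X)) j s (initial_pi B Cm X) (invmx X) k) a ->
    kap <= a) ->
  0 < eps -> eps <= 1 ->
  \forall t \near F, forall k i l,
    `|(recovered A B Cm X k - recovered (A' t) (B' t) (C' t) (X' t) k) i l| < eps.
Proof.
move=> s1 specs unb.
have pS := pd_inv pX; have uA := hseq_unbounded_unit pS unb (erefl _).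
have uW := wmx_unit uA specs.
pose e : 'M[C]_(m1 + m2, m1) := col_mx 1%:M 0; pose f : 'M[C]_(m1 + m2, m2) := col_mx 0 1%:M.
have eH : e^H = row_mx 1%:M 0 by rewrite /e adj_col adj1 adj0.
have fH : f^H = row_mx 0 1%:M by rewrite /f adj_col adj1 adj0.
have ee : e^H *m e = 1%:M by rewrite eH mul_row_col mul0mx addr0 mulmx1.
have ff : f^H *m f = 1%:M by rewrite fH mul_row_col mul0mx add0r mulmx1.
have eeH : e *m e^H = block_mx 1%:M 0 0 0.
  by rewrite eH mul_col_row !mul0mx mulmx0 mulmx1.
have ffH : f *m f^H = block_mx 0 0 0 1%:M.
  by rewrite fH mul_col_row !mul0mx mulmx0 mulmx1.
have eeff : e *m e^H + f *m f^H = 1%:M.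
  by rewrite eeH ffH add_block_mx !addr0 add0r -scalar_mx_block.
have jE : j = e *m e^H - f *m f^H.
  by rewrite eeH ffH opp_block_mx add_block_mx !oppr0 !addr0 add0r.
have je : j *m e = e by rewrite /signature /e mul_block_col !mulmx0 !mul0mx mulmx1 !addr0.
have jf : j *m f = - f.
  by rewrite /signature /f mul_block_col !mulmx0 !mul0mx mulNmx mulmx1 !add0r opp_col_mx oppr0.
(* For $s=1$ the controlled block is the first one; for $s=-1$ the roles of [e] and [f] are
   exchanged. *)
case: s1 => sE; rewrite {}sE in specs unb uW *.
  have jes : j *m e = 1 *: e by rewrite scale1r.
  apply: (recovered_stable (e := e) (f := f) (s := 1)) => //.
  - exact: rmorph1.
  - exact: mulr1.
  - by rewrite scale1r.
  - by move=> eta eta0; apply: gain_small pS jes uW eta0 unb.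
have jfs : j *m f = -1 *: f by rewrite scaleN1r.
apply: (recovered_stable (e := f) (f := e) (s := -1)) => //.
- exact: rmorphN1.
- by rewrite mulrNN mulr1.
- by rewrite addrC.
- by rewrite scaleN1r opprB.
- by move=> eta eta0; apply: gain_small pS jfs uW eta0 unb.
Qed.

End Stability.

Lemma RseqE (C : numClosedFieldType) n m (A : 'M[C]_n) (j : 'M[C]_m) P0 S0 k :
  hseq (invmx A) j 1 P0 S0 k = invmx ((1%:M + 'i *: invmx A) ^+ k) *m sseq (invmx A) j P0 S0 k
    *m invmx ((1%:M - 'i *: invmx A^H) ^+ k).
Proof. by rewrite /hseq /wmx adj_inv adj_exp adjD adjZ adj1 adj_inv !mul1r conjCi scaleNr. Qed.

Lemma QseqE (C : numClosedFieldType) n m (A : 'M[C]_n) (j : 'M[C]_m) P0 S0 k :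
  hseq (invmx A) j (-1) P0 S0 k = invmx ((1%:M - 'i *: invmx A) ^+ k) *m sseq (invmx A) j P0 S0 k
    *m invmx ((1%:M + 'i *: invmx A^H) ^+ k).
Proof.
rewrite /hseq /wmx adj_inv adj_exp adjD adjZ adj1 adj_inv !mulN1r scaleNr.
by rewrite rmorphN /= conjCi opprK.
Qed.

(** * Specialization to the complex numbers *)

Section ComplexCompactness.
Local Open Scope classical_set_scope.
Variables (R : realType) (T : Type) (F : set_system T).
Context {FU : UltraFilter F}.

Lemma fmap_ultra (U : Type) (f : T -> U) : UltraFilter (f @ F).
Proof.
split; first exact: fmap_proper_filter.
move=> G GF sFG; rewrite predeqE => B; split; last exact: sFG.
move=> GB; have [|FnB] := in_ultra_setVsetC (f @^-1` B) FU; first by [].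
have GnB : G (~` B) by apply: sFG.
by have := filter_ex (filterI GB GnB); rewrite setICr => -[].
Qed.

Lemma real_bounded_ultra_cvg (f : T -> R) (M : R) :
  (\forall t \near F, `|f t| <= M) -> exists l : R, f @ F --> l.
Proof.
move=> fM; have := @segment_compact R (- M) M; rewrite compact_ultra.
have FfU := fmap_ultra f.
move=> /(_ (f @ F) FfU) [|l [_ fl]]; last by exists l.
by apply: filterS fM => t; rewrite ler_norml => h; rewrite /= in_itv.
Qed.

Lemma complex_bounded_ultra_cvg (f : T -> (R[i] : numClosedFieldType))
    (M : (R[i] : numClosedFieldType)) :
  (\forall t \near F, `|f t| <= M) -> exists l : (R[i] : numClosedFieldType), f @ F --> l.
Proof.
move=> fM.
have [|a fa] := @real_bounded_ultra_cvg (fun t => complex.Re (f t)) (complex.Re M).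
  apply: filterS fM => t fM; have := le_trans (normc_ge_Re (f t)) fM.
  by rewrite lecE /= => /andP[].
have [|b fb] := @real_bounded_ultra_cvg (fun t => complex.Im (f t)) (complex.Re M).
  apply: filterS fM => t; rewrite normc_def lecE /= => /andP[_]; apply: le_trans.
  by rewrite -sqrtr_sqr ler_wsqrtr // lerDr sqr_ge0.
exists (Complex a b); apply/cvgrPdist_lt => e e0.
have {e0} [er er0 ->] : exists2 r : R, 0 < r & e = cR r.
  move: e0; rewrite ltcE /= => /andP[/eqP eI eR].
  by exists (complex.Re e); rewrite // /cR /real_complex_def; case: e eI {eR} => x y /= ->.
have er2 : 0 < er / 2 by rewrite divr_gt0.
have /cvgrPdist_lt/(_ _ er2) na := fa; have /cvgrPdist_lt/(_ _ er2) nb := fb.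
apply: filterS2 na nb => t; case: (f t) => x y /= lta ltb.
rewrite normc_def ltcE /= eqxx /=.
rewrite -[X in _ < X]ger0_norm ?ltW // -sqrtr_sqr ltr_sqrt ?exprn_gt0 //.
rewrite -(real_normK (num_real (a - x))) -(real_normK (num_real (b - y))).
have := normr_ge0 (a - x); have := normr_ge0 (b - y).
move: lta ltb; move: `|a - x| `|b - y| => u v.
move=> ltu ltv v0 u0; apply: (@le_lt_trans _ _ ((u + v) ^+ 2)).
  by rewrite sqrrD [X in _ <= X]addrAC lerDl mulrn_wge0 // mulr_ge0.
have uv : u + v < er by rewrite [X in _ < X](splitr er) ltrD.
by rewrite ltr_pXn2r // nnegrE ?addr_ge0 // ltW.
Qed.

End ComplexCompactness.

(** * Identification with the definitions of the statement *)

Section Statement.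
Variable R : realType.
Local Notation K := (R[i] : numClosedFieldType).

Lemma mxnorm_ge0 p q (M : 'M[R[i]]_(p, q)) : 0 <= mxnorm M.
Proof. by rewrite !sumr_ge0 // => i _; rewrite sumr_ge0. Qed.

Lemma mxnorm_entry p q (M : 'M[R[i]]_(p, q)) i j : `|M i j| <= mxnorm M.
Proof.
rewrite /mxnorm (bigD1 i) //= (bigD1 j) //= -addrA lerDl addr_ge0 //.
  by rewrite sumr_ge0.
by rewrite sumr_ge0 // => k _; rewrite sumr_ge0.
Qed.

Lemma mxnorm_le p q (M : 'M[R[i]]_(p, q)) (e : R[i]) :
  (forall i j, `|M i j| <= e) -> mxnorm M <= (p * q)%:R * e.
Proof.
move=> le_e; rewrite /mxnorm.
apply: (le_trans (y := \sum_(i < p) \sum_(j < q) e)).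
  by apply: ler_sum => i _; apply: ler_sum.
by rewrite !sumr_const !card_ord -mulrnA mulnC mulr_natl.
Qed.

Section Bridge.
Variables (n m1 m2 : nat) (A : 'M[R[i]]_n) (B : 'M[R[i]]_(n, m2)) (Cm : 'M[R[i]]_(m1, n)).
Variable X : 'M[R[i]]_n.

Lemma PiSE k : PiS A B Cm X k
  = piseq (invmx (closed_loop (C := K) A B X)) (signature K m1 m2) (initial_pi (C := K) B Cm X) k.
Proof.
elim: k => [|k IHk]; first reflexivity.
exact: (congr1 (fun P => P + 'i *: (Ainv A B X *m P *m jmx R m1 m2)) IHk).
Qed.

Lemma SSE k : SS A B Cm X k
  = sseq (invmx (closed_loop (C := K) A B X)) (signature K m1 m2) (initial_pi (C := K) B Cm X)
         (invmx X) k.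
Proof.
elim: k => [|k IHk]; first reflexivity.
exact: (congr2 (fun P S => S + Ainv A B X *m S *m adjmx (Ainv A B X)
  + Ainv A B X *m P *m adjmx P *m adjmx (Ainv A B X)) (PiSE k) IHk).
Qed.

Lemma CpotE k : Cpot A B Cm X k = recovered (C := K) A B Cm X k.
Proof. rewrite /Cpot !SSE !PiSE; reflexivity. Qed.

Lemma Rseq_hseq k : Rseq A B Cm X k
  = hseq (C := K) (invmx (closed_loop (C := K) A B X)) (signature K m1 m2) 1
      (initial_pi (C := K) B Cm X) (invmx X) k.
Proof. rewrite RseqE /Rseq SSE; reflexivity. Qed.

Lemma Qseq_hseq k : Qseq A B Cm X k
  = hseq (C := K) (invmx (closed_loop (C := K) A B X)) (signature K m1 m2) (-1)
      (initial_pi (C := K) B Cm X) (invmx X) k.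
Proof. rewrite QseqE /Qseq SSE; reflexivity. Qed.

(** A nonzero [M] violating controllability would restrict the realization to the kernel of [M], a
    state space of smaller dimension with the same transfer function. *)
Lemma minimal_controllable : minimal_realization A B Cm -> controllable (C := K) A B.
Proof.
move=> minA q M MB MA; apply/eqP/negPn/negP => M0.
have [p [V [A1 [B1 [pn BE AV]]]]] := uncontrollable_reduction M0 MB MA.
case: (minA p pn); exists A1, B1, (Cm *m V) => z uA uA1.
rewrite /transfer BE; exact: (transfer_reduction (C := K) B1 Cm AV uA uA1).
Qed.

End Bridge.

Lemma mx_tends_to_infty_unbounded p (M : nat -> 'M[R[i]]_p) : mx_tends_to_infty M ->
  forall kap : K, 0 < kap -> exists k, forall a, eigenvalue (M k) a -> kap <= a.
Proof.
move=> Minf kap kap0; have [N MN] := Minf (complex.Re kap).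
exists N => a aN; have := MN N (leqnn N) a aN.
by rewrite /cR RRe_real // ger0_real // ltW.
Qed.

End Statement.

Lemma mxnorm_mcvg (R : realType) (F : set_system nat) p q (f : nat -> 'M[R[i]]_(p, q))
    (L : 'M[R[i]]_(p, q)) : Filter F -> (\oo `<=` F)%classic ->
  (forall t, mxnorm (L - f t) < cR (t.+1%:R^-1)) ->
  mcvg (C := (R[i] : numClosedFieldType)) F f L.
Proof.
move=> FF sF fL i j; apply/cvgrPdist_lt => e e0.
have [er er0 ->] : exists2 r : R, 0 < r & e = cR r.
  exists (complex.Re e); last by rewrite /cR RRe_real // gtr0_real.
  by move: e0; rewrite ltcE => /andP[].
apply: sF; apply: filterS (near_infty_natSinv_lt (PosNum er0)) => t /= lt_er.
apply: le_lt_trans (_ : mxnorm (L - f t) < _); last first.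
  by apply: lt_trans (fL t) _; rewrite ltcE /= eqxx.
have := mxnorm_entry (L - f t) i j; rewrite mxE [X in _ + X]mxE; exact.
Qed.

Theorem theorem4p4 (R : realType) (n m1 m2 : nat)
  (A : 'M[R[i]]_n) (B : 'M[R[i]]_(n, m2)) (Cm : 'M[R[i]]_(m1, n))
  (X : 'M[R[i]]_n) :
  in_Gn A B Cm ->
  riccati_sol A B Cm X ->
  (mx_tends_to_infty (Rseq A B Cm X)
   \/ (~~ eigenvalue (Aproc A B X) 'i /\ mx_tends_to_infty (Qseq A B Cm X))) ->
  forall eps : R, 0 < eps ->
  exists2 delta : R, 0 < delta &
    forall (A' : 'M[R[i]]_n) (B' : 'M[R[i]]_(n, m2)) (C' : 'M[R[i]]_(m1, n))
           (X' : 'M[R[i]]_n),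
      in_Gn A' B' C' ->
      mxnorm (A - A') + mxnorm (B - B') + mxnorm (Cm - C') < cR delta ->
      riccati_sol A' B' C' X' ->
      forall k : nat, mxnorm (Cpot A B Cm X k - Cpot A' B' C' X' k) < cR eps.
Proof.
move=> [minA _] [pX ricX specX] unb eps eps0; apply: contrapT => unstable.
(* Negating stability gives, for each $\delta=1/(t+1)$, a perturbed triple with its Riccati solution
   for which some $C_k$ is at least $\varepsilon$ away. *)
have bad (t : nat) : exists d : 'M[R[i]]_n * 'M[R[i]]_(n, m2) * 'M[R[i]]_(m1, n) * 'M[R[i]]_n,
    [/\ mxnorm (A - d.1.1.1) + mxnorm (B - d.1.1.2) + mxnorm (Cm - d.1.2) < cR (t.+1%:R^-1),
        riccati_sol d.1.1.1 d.1.1.2 d.1.2 d.2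
      & exists k, ~ mxnorm (Cpot A B Cm X k - Cpot d.1.1.1 d.1.1.2 d.1.2 d.2 k) < cR eps].
  apply: contrapT => good; apply: unstable; exists (t.+1%:R^-1); first by rewrite invr_gt0.
  move=> A' B' C' X' _ close ric' k; apply: contrapT => far; apply: good.
  by exists (A', B', C', X'); split=> //; exists k.
have [d dP] := choice bad.
(* Refining the filter at infinity keeps the convergence of the triples and makes bounded sequences
   converge. *)
have [F [FU sF]] := ultraFilterLemma (F := \oo%classic) _.
pose A' t := (d t).1.1.1; pose B' t := (d t).1.1.2; pose C' t := (d t).1.2; pose X' t := (d t).2.
have le_norms (x y z : R[i]) e : 0 <= x -> 0 <= y -> 0 <= z -> x + y + z < e ->
    [/\ x < e, y < e & z < e].
  move=> x0 y0 z0 lt_e; split; apply: le_lt_trans lt_e.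
  - by rewrite -addrA lerDl addr_ge0.
  - by rewrite addrAC lerDr addr_ge0.
  - by rewrite lerDr addr_ge0.
have norms t : [/\ mxnorm (A - A' t) < cR (t.+1%:R^-1), mxnorm (B - B' t) < cR (t.+1%:R^-1)
    & mxnorm (Cm - C' t) < cR (t.+1%:R^-1)].
  by have [lt_t _ _] := dP t; apply: le_norms lt_t; apply: mxnorm_ge0.
have FF : Filter F by apply: filter_filter.
pose K := (R[i] : numClosedFieldType).
have toA : mcvg (C := K) F A' A by apply: mxnorm_mcvg => // t; have [] := norms t.
have toB : mcvg (C := K) F B' B by apply: mxnorm_mcvg => // t; have [] := norms t.
have toC : mcvg (C := K) F C' Cm by apply: mxnorm_mcvg => // t; have [] := norms t.
have pX' t : pd (C := K) (X' t) by have [_ [? _ _] _] := dP t.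
have ricX' t : riccati (C := K) (A' t) (B' t) (C' t) (X' t) = 0 by have [_ [_ ? _] _] := dP t.
have specX' t (a : K) :
    eigenvalue (A' t - ('i : K) *: (B' t *m adj (C := K) (B' t) *m X' t)) a -> 0 <= 'Im a.
  by have [_ [_ _ +] _] := dP t; apply.
have toX : mcvg (C := K) F X' X.
  apply: (riccati_cvg (C := K) _ toA toB toC (fun t => pd_psd (pX' t)) ricX' specX'
           (minimal_controllable minA) (proj1 pX) ricX specX).
  exact: complex_bounded_ultra_cvg.
have Clm : exists2 s : K, s = 1 \/ s = -1 &
    ~~ eigenvalue (closed_loop (C := K) A B X) (- (s * 'i)) /\
    (forall kap : K, 0 < kap -> exists k, forall a,
      eigenvalue (hseq (C := K) (invmx (closed_loop (C := K) A B X)) (signature K m1 m2) s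
        (initial_pi (C := K) B Cm X) (invmx X) k) a -> kap <= a).
  case: unb => [Rinf|[i_notin Qinf]].
    exists 1; first by left.
    (* For $s=1$ the excluded eigenvalue is $-\mathrm{i}$, ruled out by the spectral condition on
       the closed loop. *)
    split; first apply/negP => /specX.
      by rewrite mul1r raddfN /= Im_i oppr_ge0 ler10.
    move=> kap /(mx_tends_to_infty_unbounded Rinf)[k kP]; exists k => a.
    by rewrite -Rseq_hseq; apply: kP.
  exists (-1); first by right.
  split; first by rewrite mulN1r opprK.
  move=> kap /(mx_tends_to_infty_unbounded Qinf)[k kP]; exists k => a.
  by rewrite -Qseq_hseq; apply: kP.
have [s s1 [spec_s unb_s]] := Clm.
(* The entrywise bound $r$ is summed over $(m_1+m_2)^2$ entries; the successor in the denominator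
   makes the total strictly less than $\varepsilon$ and avoids division by zero. *)
pose r := Num.min eps 1 / ((m1 + m2) * (m1 + m2)).+1%:R.
have min0 : 0 < Num.min eps 1 by rewrite lt_min eps0 ltr01.
have r0 : 0 < cR r by rewrite ltcE /= eqxx /= divr_gt0 ?ltr0n.
have r1 : cR r <= 1.
  rewrite lecE /= eqxx /= ler_pdivrMr ?ltr0n // mul1r.
  by apply: le_trans (_ : 1 <= _); rewrite ?ge_min ?lexx ?orbT // ler1n.
have FP : ProperFilter F by apply: ultra_proper.
have near_good := recovered_stable_unbounded (C := K) (FF := FP) toA toB toC toX pX pX' ricX
  ricX' s1 spec_s unb_s r0 r1.
have [t good] := filter_ex near_good; have [_ _ [k]] := dP t; apply.
apply: le_lt_trans (mxnorm_le (e := cR r) _) _.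
  by move=> i l; rewrite !CpotE; apply/ltW/good.
have -> : ((m1 + m2) * (m1 + m2))%:R = cR ((m1 + m2) * (m1 + m2))%:R :> R[i].
  by rewrite /cR rmorph_nat.
rewrite /cR -rmorphM ltcE /= eqxx /=.
rewrite /r mulrA ltr_pdivrMr ?ltr0n // mulrC.
apply: (@lt_le_trans _ _ (Num.min eps 1 * ((m1 + m2) * (m1 + m2)).+1%:R)).
  by rewrite ltr_pM2l // ltr_nat.
by rewrite ler_pM2r ?ltr0n // ge_min lexx.
Qed.
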